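(* Let $f_0:\mathbb{R}^n\to\overline{\mathbb{R}}$, $F:\mathbb{R}^n\to\mathbb{R}^m\cup\{+\infty_\bullet\}$ and $g:\mathbb{R}^m\to\overline{\mathbb{R}}$ be arbitrary functions. For $y\in\mathbb{R}^m$ define $\langle y,F\rangle:\mathbb{R}^n\to\overline{\mathbb{R}}$ by $\langle y,F\rangle(x)=\langle y,F(x)\rangle$ if $x\in\operatorname{dom}(F)$ and $+\infty$ otherwise; define $\rho:\mathbb{R}^n\to\overline{\mathbb{R}}$ by $$\rho(\bar v):=\inf_{y\in\mathbb{R}^m}\left\{(f_0+\langle y,F\rangle)^*(\bar v)+g^*(y)\right\},$$ and $f_0+g\circ F:\mathbb{R}^n\to\overline{\mathbb{R}}$ by $(f_0+g\circ F)(x)=f_0(x)+g(F(x))$ if $x\in\operatorname{dom}(F)$ and $+\infty$ otherwise. Then $\rho$ is convex, and for every $\bar v\in\mathbb{R}^n$ $$(f_0+g\circ F)^*(\bar v)\le \operatorname{cl}\rho(\bar v).\qquad (\ast)$$ Moreover, for any $(\bar v,\bar x,\bar y)\in\mathbb{R}^n\times\mathbb{R}^n\times\mathbb{R}^m$, the pair of conditions $$(f_0+g\circ F)(\bar x)+(f_0+g\circ F)^*(\bar v)=\langle\bar v,\bar x\rangle,\qquad (f_0+g\circ F)^*(\bar v)=(f_0+\langle\bar y,F\rangle)^*(\bar v)+g^*(\bar y)$$ is equivalent to the pair of conditions $$g(F(\bar x))+g^*(\bar y)=\langle\bar y,F(\bar x)\rangle,\qquad (f_0+\langle\bar y,F\rangle)(\bar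 x)+(f_0+\langle\bar y,F\rangle)^*(\bar v)=\langle\bar v,\bar x\rangle.$$ Finally, let $f:\mathbb{R}^n\times\mathbb{R}^m\to\overline{\mathbb{R}}$ be given by $f(x,u)=f_0(x)+g(F(x)+u)$ if $x\in\operatorname{dom}(F)$ and $+\infty$ otherwise, and let $$U:=\left\{u\in\mathbb{R}^m:\inf_{x\in\mathbb{R}^n}f(x,u)<+\infty\right\}=\operatorname{dom}(g)-F\left(\operatorname{dom}(f_0)\cap\operatorname{dom}(F)\right).$$ Assume $f\in\Gamma_0(\mathbb{R}^n\times\mathbb{R}^m)$. Then: 1. If $0\in U$, then $\rho\in\Gamma(\mathbb{R}^n)$. 2. If $\rho\in\Gamma(\mathbb{R}^n)$ (e.g. if $0\in U$), then $(\ast)$ holds with equality (for every $\bar v\in\mathbb{R}^n$). 3. If $0\in\operatorname{rint}(U)$, or if $0\in U$ and $f$ is piecewise linear-quadratic, then $\rho\in\Gamma_0(\mathbb{R}^n)$ and, for every $\bar v$, the infimum defining $\rho(\bar v)$ is a minimum (possibly with $\rho(\bar v)=(f_0+\langle y,F\rangle)^*(\bar v)+g^*(y)=+\infty$ for all $y\in\mathbb{R}^m$).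
   Context: $\overline{\mathbb{R}}=\mathbb{R}\cup\{-\infty,+\infty\}$; sums of opposite infinities follow the convention $(+\infty)+(-\infty)=+\infty$. For $h:\mathbb{R}^p\to\overline{\mathbb{R}}$: $\operatorname{dom}(h)=\{x:h(x)<+\infty\}$, $\operatorname{epi}(h)=\{(x,\alpha)\in\mathbb{R}^p\times\mathbb{R}:h(x)\le\alpha\}$, $\operatorname{cl}(h)$ is the function with $\operatorname{epi}(\operatorname{cl}(h))=\operatorname{cl}(\operatorname{epi}(h))$, and $h^*(v)=\sup_{x\in\mathbb{R}^p}\{\langle v,x\rangle-h(x)\}$. $h$ is convex (closed) if $\operatorname{epi}(h)$ is convex (closed), and proper if $h\not\equiv+\infty$ and $h>-\infty$ everywhere. $\Gamma(\mathbb{R}^p)$ is the set of proper convex functions $\mathbb{R}^p\to\overline{\mathbb{R}}$, and $\Gamma_0(\mathbb{R}^p)$ the set of closed functions in $\Gamma(\mathbb{R}^p)$. $\operatorname{rint}$ denotes relative interior. $+\infty_\bullet$ is an extra ''infinite element'' adjoined to $\mathbb{R}^m$; for $F:\mathbb{R}^n\to\mathbb{R}^m\cup\{+\infty_\bullet\}$, $\operatorname{dom}(F)=\{x:F(x)\neq+\infty_\bullet\}$. When $\bar x\notin\operatorname{dom}(F)$, $g(F(\bar x))$ and $\langle \bar y,F(\bar x)\rangle$ are read as $+\infty$. A function $h:\mathbb{R}^p\to\mathbb{R}\cup\{+\infty\}$ is piecewise linear-quadratic if there are a finite index set $I$ and, for each $i\in I$, a polyhedron $P_i\subseteq\mathbb{R}^p$,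 $A^i\in\mathbb{R}^{p\times p}$, $q^i\in\mathbb{R}^p$, $u_i\in\mathbb{R}$ such that $h(x)=\frac12\langle x,A^ix\rangle+\langle q^i,x\rangle-u_i$ for $x\in P_i$, $i\in I$, and $h(x)=+\infty$ for $x\notin\bigcup_{i\in I}P_i$. *)

(* Defs.v *)
From HB Require Import structures.
From mathcomp Require Import all_boot all_order all_algebra.
From mathcomp Require Import all_classical all_reals all_analysis.

Set Implicit Arguments.
Unset Strict Implicit.
Unset Printing Implicit Defensive.

Import Order.TTheory GRing.Theory Num.Theory.
Import numFieldNormedType.Exports.

Local Open Scope classical_set_scope.
Local Open Scope ring_scope.
Local Open Scope ereal_scope.

(* R^p is 'rV[R]_p, and R^n x R^m is identified with 'rV[R]_(n + m) through
   row_mx.  Sums of extended reals that may involve opposite infinities use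
   the dual addition (_ + _)%dE, for which +oo + -oo = +oo. *)

Section ExtendedFunctions.
Context {R : realType} {p : nat}.
Implicit Types (h : 'rV[R]_p -> \bar R) (S : set 'rV[R]_p).

Definition dot (u v : 'rV[R]_p) : R := (\sum_(i < p) u ord0 i * v ord0 i)%R.

Definition edom h : set 'rV[R]_p := [set x | h x < +oo].

(* R^o is R seen as a module over itself, so that convex_set applies. *)
Definition epi h : set ('rV[R]_p * R^o) := [set z | h z.1 <= (z.2)%:E].

(* The unique function whose epigraph is closure (epi h); see epi_efun_cl. *)
Definition efun_cl h (x : 'rV[R]_p) : \bar R :=
  ereal_inf [set a%:E | a in [set a : R | closure (epi h) (x, a)]].

(* No opposite infinities can meet here: the first term is finite. *)
Definition conjugate h (v : 'rV[R]_p) : \bar R :=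
  ereal_sup (range (fun x => (dot v x)%:E - h x)).

Definition econvex h : Prop := convex_set (epi h).

Definition eclosed h : Prop := closed (epi h).

Definition proper h : Prop :=
  (exists x, h x != +oo) /\ (forall x, -oo < h x).

Definition Gamma : set ('rV[R]_p -> \bar R) :=
  [set h | proper h /\ econvex h].

Definition Gamma0 : set ('rV[R]_p -> \bar R) :=
  [set h | Gamma h /\ eclosed h].

Definition affine_set S : Prop :=
  forall (x y : 'rV[R]_p) (t : R),
    S x -> S y -> S ((1 - t) *: x + t *: y)%R.

Definition affine_hull S : set 'rV[R]_p := smallest affine_set S.

Definition rint S : set 'rV[R]_p :=
  [set x | affine_hull S x /\ \forall z \near x, affine_hull S z -> S z].

Definition polyhedron S : Prop :=
  exists (k : nat) (a : 'I_k -> 'rV[R]_p) (b : 'I_k -> R),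
    S = [set x | forall j, (dot (a j) x <= b j)%R].

(* x *m (A i)^T is the row vector of the matrix-vector product A^i x. *)
Definition piecewise_linear_quadratic h : Prop :=
  exists (k : nat) (P : 'I_k -> set 'rV[R]_p) (A : 'I_k -> 'M[R]_p)
         (q : 'I_k -> 'rV[R]_p) (u : 'I_k -> R),
    [/\ forall i, polyhedron (P i),
        forall i x, P i x ->
          h x = (2^-1 * dot x (x *m (A i)^T) + dot (q i) x - u i)%:E
      & forall x, ~ (\bigcup_(i in setT) P i) x -> h x = +oo].

Lemma closure_epi_up h x (a b : R) :
  (a <= b)%R -> closure (epi h) (x, a) -> closure (epi h) (x, b).
Proof.
move=> ab cl B [[/= X Y] [/= Xx Yb] XYB].
have cv : (fun t : R^o => (t + (b - a))%R : R^o) @ (a : R^o) --> (b : R^o).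
  rewrite -[X in _ --> X](subrKC a b).
  by apply: cvgD; [exact: cvg_id|exact: cvg_cst].
have /cl[[z t] /= [zt [Xz Yt]]] :
    nbhs ((x, a) : 'rV[R]_p * R^o)
      (X `*` [set t : R^o | Y (t + (b - a))%R]).
  by exists (X, [set t : R^o | Y (t + (b - a))%R]) => //=; split => //; exact: cv.
exists (z, t + (b - a))%R; split; last exact: XYB.
by apply: le_trans zt _; rewrite lee_fin /= lerDl subr_ge0.
Qed.

Lemma epi_efun_cl h : epi (efun_cl h) = closure (epi h).
Proof.
apply/seteqP; split => -[x a] /=; last first.
  by move=> cl; apply: ereal_inf_lbound; exists a.
rewrite /epi /= => xa.
suff : closure (closure (epi h)) (x, a).
  by rewrite -(proj1 (closure_id _) (@closed_closure _ (epi h))).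
move=> B [[/= X Y] [/= Xx]] /nbhs_ballP[e /= e0 aeY] XYB.
have : efun_cl h x < (a + e / 2)%:E.
  by apply: (le_lt_trans xa); rewrite lte_fin ltrDl divr_gt0.
move=> /ereal_inf_lt[_ [b clb <-]]; rewrite lte_fin => /ltW bae.
exists (x, a + e / 2)%R; split; first exact: closure_epi_up bae clb.
apply: XYB; split => /=; first exact: nbhs_singleton.
apply: aeY; rewrite /ball /= opprD addrA subrr add0r normrN gtr0_norm ?divr_gt0//.
by rewrite ltr_pdivrMr// ltr_pMr// ltr1n.
Qed.

End ExtendedFunctions.

(* A map into R^m extended by one infinite element is an option-valued
   function, None being the infinite element. *)
Section CompositeProblem.
Context {R : realType} {n m : nat}.
Variables (f0 : 'rV[R]_n -> \bar R) (F : 'rV[R]_n -> option 'rV[R]_m)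
  (g : 'rV[R]_m -> \bar R).

Definition odom : set 'rV[R]_n := [set x | F x <> None].

Definition oimage (D : set 'rV[R]_n) : set 'rV[R]_m :=
  [set z | exists2 x, D x & F x = Some z].

Definition scalarization (y : 'rV[R]_m) (x : 'rV[R]_n) : \bar R :=
  if F x is Some z then (dot y z)%:E else +oo.

Definition ocomp (x : 'rV[R]_n) : \bar R :=
  if F x is Some z then g z else +oo.

Definition f0_plus_scal (y : 'rV[R]_m) (x : 'rV[R]_n) : \bar R :=
  (f0 x + scalarization y x)%dE.

Definition f0_plus_comp (x : 'rV[R]_n) : \bar R :=
  if F x is Some z then (f0 x + g z)%dE else +oo.

Definition dual_obj (v : 'rV[R]_n) (y : 'rV[R]_m) : \bar R :=
  (conjugate (f0_plus_scal y) v + conjugate g y)%dE.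

Definition rho (v : 'rV[R]_n) : \bar R := ereal_inf (range (dual_obj v)).

Definition perturbation (xu : 'rV[R]_(n + m)) : \bar R :=
  let x := lsubmx xu in let u := rsubmx xu in
  if F x is Some z then (f0 x + g (z + u)%R)%dE else +oo.

Definition feasible_perturbations : set 'rV[R]_m :=
  [set u | ereal_inf (range (fun x => perturbation (row_mx x u))) < +oo].

End CompositeProblem.

(* Main.v *)
(* Write phi = f0 + g o F and f for the perturbation.  A minorant
   c + <v, x> + <y, u> <= f(x, u) is the same as dual_obj v y <= - c, so every
   equality reduces to producing affine minorants of convex functions.  These
   are built one coordinate at a time: choosing one slope is a supremum over a
   line (one-dimensional Hahn-Banach), which needs points of the domain on both
   sides of the slice.  This yields an affine minorant of any proper convex
   function and, by enlarging the domain with a multiple of the l1 norm, a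
   subgradient at any point where the function is calm.  Lower semicontinuity
   at a point gives calmness there once an affine minorant has been subtracted,
   whence phi^* = cl rho by applying this to rho and then to f.
   Attainment at v is a subgradient at 0 of u |-> inf_x (f(x, u) - <v, x>).  If
   0 is in rint U the coordinate argument applies directly.  If f is piecewise
   linear-quadratic, the variables x are eliminated one by one as in
   Fourier-Motzkin elimination: a quadratic on a polyhedral slice of a line
   attains its infimum at the vertex or at the root of a constraint, or else
   decreases linearly along a ray; the latter is a recession direction of the
   whole epigraph, which contradicts finiteness at 0.  The value function is
   thus piecewise linear-quadratic, hence calm at 0. *)
Require Import Defs.
From mathcomp Require Import all_boot all_order all_algebra.
From mathcomp Require Import all_classical all_reals all_analysis.
From mathcomp Require Import ring lra.

Import Order.TTheory GRing.Theory Num.Theory.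
Import numFieldNormedType.Exports DualAddTheory.

Local Open Scope classical_set_scope.
Local Open Scope ring_scope.

(** * Inner product and l1 norm on row vectors *)

Section Dot.
Context {R : realType} {p : nat}.
Implicit Types u v w : 'rV[R]_p.

Lemma dotC u v : dot u v = dot v u.
Proof. by apply: eq_bigr => i _; rewrite mulrC. Qed.

Lemma dotDr u v w : dot u (v + w) = dot u v + dot u w.
Proof. by rewrite -big_split; apply: eq_bigr => i _; rewrite mxE mulrDr. Qed.

Lemma dotZr (a : R) u v : dot u (a *: v) = a * dot u v.
Proof. by rewrite /dot big_distrr; apply: eq_bigr => i _; rewrite mxE mulrCA. Qed.

Lemma dotDl u v w : dot (u + v) w = dot u w + dot v w.
Proof. by rewrite dotC dotDr !(dotC w). Qed.

Lemma dotZl (a : R) u v : dot (a *: u) v = a * dot u v.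
Proof. by rewrite dotC dotZr dotC. Qed.

Lemma dotNr u v : dot u (- v) = - dot u v.
Proof. by rewrite -scaleN1r dotZr mulN1r. Qed.

Lemma dotNl u v : dot (- u) v = - dot u v.
Proof. by rewrite dotC dotNr dotC. Qed.

Lemma dot0r u : dot u 0 = 0.
Proof. by rewrite -(scale0r (0 : 'rV[R]_p)) dotZr mul0r. Qed.

Lemma dot0l u : dot 0 u = 0.
Proof. by rewrite dotC dot0r. Qed.

Lemma dot_delta i u : dot (delta_mx ord0 i) u = u ord0 i.
Proof.
rewrite /dot (bigD1 i) //= big1 => [|j /negPf ji].
  by rewrite mxE !eqxx mul1r addr0.
by rewrite mxE ji andbF mul0r.
Qed.

Definition norm1 u : R := \sum_(i < p) `|u ord0 i|.

Lemma norm1_ge0 u : 0 <= norm1 u.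
Proof. exact: sumr_ge0. Qed.

Lemma norm1_0 : norm1 0 = 0.
Proof. by apply: big1 => i _; rewrite mxE normr0. Qed.

Lemma norm1D u v : norm1 (u + v) <= norm1 u + norm1 v.
Proof.
by rewrite -big_split; apply: ler_sum => i _; rewrite mxE; exact: ler_normD.
Qed.

Lemma norm1Z (a : R) u : norm1 (a *: u) = `|a| * norm1 u.
Proof. by rewrite /norm1 big_distrr; apply: eq_bigr => i _; rewrite mxE normrM. Qed.

Lemma norm1N u : norm1 (- u) = norm1 u.
Proof. by apply: eq_bigr => i _; rewrite mxE normrN. Qed.

Lemma ler_norm_norm1 u : `|u| <= norm1 u.
Proof.
suff : mx_norm u <= norm1 u by [].
rewrite mx_normrE; apply/bigmax_leP; split => [|[i j] _ /=]; first exact: norm1_ge0.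
rewrite /norm1 (bigD1 j)//= (ord1 i) lerDl; exact: sumr_ge0.
Qed.

Lemma dot_le_norm1 u v : `|dot u v| <= norm1 u * norm1 v.
Proof.
apply: (le_trans (ler_norm_sum _ _ _)); rewrite /norm1 big_distrl /=.
apply: ler_sum => i _; rewrite normrM ler_wpM2l//.
rewrite (bigD1 i)//= lerDl; exact: sumr_ge0.
Qed.

End Dot.

(** * Affine minorants of convex epigraphs *)

Section ConvexRelations.
Context {R : realType} {p : nat}.
Implicit Types (K : 'rV[R]_p -> R -> Prop) (y z : 'rV[R]_p).

(** [K z a] plays the role of an epigraph, but its fibres need be neither closed nor upward closed,
    so slices and projections stay in the class. *)
Definition convex_rel K := forall z a z' a' (s : R), 0 < s < 1 ->
  K z a -> K z' a' -> K ((1 - s) *: z + s *: z') ((1 - s) * a + s * a').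

(** The slope is the supremum of [b / t] over the points with [t < 0]. The first hypothesis bounds
    it by the slopes with [t > 0]; the third makes both sides inhabited as soon as some [t] is
    nonzero. *)
Lemma slope_between (W : R -> R -> Prop) :
  (forall t b t' b', W t b -> W t' b' -> t' < 0 < t -> b' / t' <= b / t) ->
  (forall b, W 0 b -> 0 <= b) ->
  (forall t b, W t b -> t != 0 -> exists t' b', W t' b' /\ t * t' < 0) ->
  exists s, forall t b, W t b -> s * t <= b.
Proof.
move=> cross W0 opp.
have [[t0 [b0 [Wt0 t0n]]]|Wz] := pselect (exists t b, W t b /\ t != 0); last first.
  exists 0 => t b Wtb; rewrite mul0r; apply: W0.
  have [<-//|tn] := eqVneq t 0; by exfalso; apply: Wz; exists t, b.
have [t1 [b1 [Wt1 t01]]] := opp _ _ Wt0 t0n.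
have [tp [bp [tm [bm [Wp Wm tmp]]]]] : exists tp bp tm bm,
    [/\ W tp bp, W tm bm & tm < 0 < tp].
  have [t0p|t0m|t0z] := ltgtP 0 t0.
  - by exists t0, b0, t1, b1; split=> //; rewrite t0p -(pmulr_rlt0 _ t0p) t01.
  - by exists t1, b1, t0, b0; split=> //; rewrite t0m -(nmulr_rlt0 _ t0m) t01.
  - by rewrite -t0z eqxx in t0n.
pose S := [set s : R | exists t b, [/\ W t b, t < 0 & s = b / t]].
have [tm0 tp0] := andP tmp.
have Sne : S !=set0 by exists (bm / tm), tm, bm.
have Sub t b : W t b -> 0 < t -> ubound S (b / t).
  by move=> Wt tpos _ [t' [b' [Wt' t'0 ->]]]; apply: cross => //; rewrite t'0.
have Ssup : has_sup S by split => //; exists (bp / tp); exact: Sub.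
exists (sup S) => t b Wtb; have [tpos|tneg|tz] := ltgtP 0 t.
- by rewrite -ler_pdivlMr//; apply: ge_sup => //; exact: Sub.
- rewrite -ler_ndivrMr//; apply: ub_le_sup; first exact: Ssup.2.
  by exists t, b.
- by rewrite -tz mulr0; apply: W0; rewrite tz.
Qed.

(** A segment joining opposite sides of the hyperplane [z ord0 i = tau] crosses it, where the
    minorant is known. This orders the slopes of the excess [a - (c + dot y z)] as [slope_between]
    requires. *)
Lemma affine_minorant_step K i (tau c : R) y : convex_rel K ->
  (forall z a, K z a -> z ord0 i = tau -> c + dot y z <= a) ->
  (forall z a, K z a -> z ord0 i != tau ->
     exists z' a', K z' a' /\ (z ord0 i - tau) * (z' ord0 i - tau) < 0) ->
  exists s, forall z a, K z a -> c + dot y z + s * (z ord0 i - tau) <= a.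
Proof.
move=> cK slice opp.
pose W (t b : R) := exists z a, [/\ K z a, t = z ord0 i - tau & b = a - (c + dot y z)].
have [|||s hs] := @slope_between W.
- move=> t b t' b' [z [a [Kz -> ->]]] [z' [a' [Kz' -> ->]]] /andP[].
  set u := z ord0 i - tau; set u' := z' ord0 i - tau => u'0 u0.
  have uu : 0 < u - u' by rewrite subr_gt0 (lt_trans u'0).
  have un : u - u' != 0 by rewrite gt_eqF.
  (* The parameter at which the segment from [z] to [z'] meets the hyperplane. *)
  pose s := u / (u - u').
  have s01 : 0 < s < 1.
    by rewrite /s divr_gt0//= ltr_pdivrMr// mul1r ltrDl oppr_gt0.
  have := slice _ _ (cK _ _ _ _ _ s01 Kz Kz').
  rewrite !mxE dotDr !dotZr.
  have -> : (1 - s) * z ord0 i + s * z' ord0 i = tau.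
    have -> : z ord0 i = u + tau by rewrite /u subrK.
    have -> : z' ord0 i = u' + tau by rewrite /u' subrK.
    by rewrite /s; field.
  move=> /(_ erefl) h.
  rewrite ler_pdivlMr// mulrAC ler_ndivrMr// -subr_ge0.
  have := h; rewrite -subr_ge0 -(pmulr_rge0 _ uu) => /le_trans; apply.
  rewrite le_eqVlt; apply/orP; left; apply/eqP.
  by rewrite /s; field.
- move=> b [z [a [Kz t0 ->]]]; rewrite subr_ge0; apply: slice => //.
  by apply/eqP; rewrite -subr_eq0 -t0.
- move=> t b [z [a [Kz -> _]]]; rewrite subr_eq0 => zi.
  have [z' [a' [Kz' ?]]] := opp _ _ Kz zi.
  by exists (z' ord0 i - tau), (a' - (c + dot y z')); split=> //; exists z', a'.
exists s => z a Kz; have := hs (z ord0 i - tau) (a - (c + dot y z)).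
rewrite lerBrDl; apply; by exists z, a.
Qed.

Lemma convex_rel_slice K i (tau : R) :
  convex_rel K -> convex_rel (fun z a => K z a /\ z ord0 i = tau).
Proof.
move=> cK z a z' a' s s01 [Kz zi] [Kz' z'i]; split; first exact: cK.
by rewrite !mxE zi z'i; ring.
Qed.

(** Induction on the list [J] of coordinates that may be nonzero on [K]: slicing at zero removes
    one, and [affine_minorant_step] restores it, the core condition supplying points on both
    sides. *)
Lemma support_at_core K (c : R) : convex_rel K ->
  (forall a, K 0 a -> c <= a) ->
  (forall z a, K z a -> exists2 e, 0 < e & exists b, K (- (e *: z)) b) ->
  exists y, forall z a, K z a -> c + dot y z <= a.
Proof.
move=> cK K0 core.
have : forall z a, K z a -> forall j, j \notin enum 'I_p -> z ord0 j = 0.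
  by move=> z a _ j; rewrite mem_enum.
move: (enum _) => J; elim: J K cK K0 core => [|i J IH] K cK K0 core KJ.
  exists 0 => z a Kz; rewrite dot0l addr0; apply: K0; rewrite -(_ : z = 0)//.
  by apply/rowP => j; rewrite mxE (KJ _ _ Kz).
have [||z a [Kz zi]|z a [Kz zi] j jJ|y hy] := IH (fun z a => K z a /\ z ord0 i = 0).
- exact: convex_rel_slice.
- by move=> a [/K0].
- have [e e0 [b Kb]] := core _ _ Kz; exists e => //; exists b; split => //.
  by rewrite !mxE zi mulr0 oppr0.
- have [->//|ji] := eqVneq j i.
  by apply: KJ Kz _ _; rewrite inE negb_or ji.
have [||s hs] := @affine_minorant_step K i 0 c y cK.
- by move=> z a Kz zi; apply: hy.
- move=> z a Kz zi; have [e e0 [b Kb]] := core _ _ Kz.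
  exists (- (e *: z)), b; split => //; rewrite !mxE !subr0 mulrN oppr_lt0 mulrCA.
  by rewrite pmulr_rgt0// lt_neqAle eq_sym mulf_neq0// -expr2 sqr_ge0.
exists (y + s *: delta_mx ord0 i) => z a /hs.
by rewrite dotDl dotZl dot_delta subr0 addrA.
Qed.

(** Here [J] lists the coordinates that may vary over the domain. With no central point at hand, the
    slice is put midway between two distinct values of a coordinate, so that both sides are
    inhabited. *)
Lemma exists_affine_minorant K : convex_rel K ->
  (exists z a, K z a) -> (forall z, exists M, forall a, K z a -> M <= a) ->
  exists y c, forall z a, K z a -> c + dot y z <= a.
Proof.
move=> cK K0 bK.
have : forall z a z' a', K z a -> K z' a' ->
    forall j, j \notin enum 'I_p -> z ord0 j = z' ord0 j.
  by move=> z a z' a' _ _ j; rewrite mem_enum.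
move: (enum _) => J; elim: J K cK K0 bK => [|i J IH] K cK [z0 [a0 K0]] bK KJ.
  have [M hM] := bK z0; exists 0, M => z a Kz; rewrite dot0l addr0; apply: hM.
  by rewrite -(_ : z = z0)//; apply/rowP => j; rewrite (KJ _ _ _ _ Kz K0).
have [Kc|/existsNP[z1 /existsNP[a1 /not_implyP[K1 z10]]]] :=
  pselect (forall z a, K z a -> z ord0 i = z0 ord0 i).
  apply: IH => //; first by exists z0, a0.
  move=> z a z' a' Kz Kz' j jJ; have [->|ji] := eqVneq j i.
    by rewrite (Kc _ _ Kz) (Kc _ _ Kz').
  by apply: KJ Kz Kz' _ _; rewrite inE negb_or ji.
pose tau := (z0 ord0 i + z1 ord0 i) / 2.
have h01 : 0 < 2^-1 :> R by rewrite invr_gt0.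
have h12 : 0 < (2^-1 : R) < 1 by rewrite h01 invf_lt1// ltr1n.
have Kmid := cK _ _ _ _ _ h12 K0 K1.
have [|||z a z' a' [Kz zi] [Kz' z'i] j jJ|y [c hy]] := IH (fun z a =>
  K z a /\ z ord0 i = tau).
- exact: convex_rel_slice.
- by eexists; eexists; split; [exact: Kmid|]; rewrite !mxE /tau; field.
- by move=> z; have [M hM] := bK z; exists M => a [/hM].
- have [->|ji] := eqVneq j i; first by rewrite zi z'i.
  by apply: KJ Kz Kz' _ _; rewrite inE negb_or ji.
have [||s hs] := @affine_minorant_step K i tau c y cK.
- by move=> z a Kz zi; apply: hy.
- move=> z a Kz; rewrite -subr_eq0 => zi.
  have d0 : (z0 ord0 i - tau) != 0.
    have -> : z0 ord0 i - tau = (z0 ord0 i - z1 ord0 i) / 2 by rewrite /tau; field.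
    rewrite mulf_neq0 ?invr_neq0 ?pnatr_eq0// subr_eq0; apply/eqP => e; exact/z10/esym.
  have d1 : z1 ord0 i - tau = - (z0 ord0 i - tau) by rewrite /tau; field.
  have [d|d|/eqP d] := ltgtP ((z ord0 i - tau) * (z0 ord0 i - tau)) 0.
  + by exists z0, a0.
  + by exists z1, a1; split => //; rewrite d1 mulrN oppr_lt0.
  + by move: d; rewrite mulf_eq0 (negPf zi) (negPf d0).
exists (y + s *: delta_mx ord0 i), (c - s * tau) => z a /hs.
by rewrite dotDl dotZl dot_delta => h; apply: le_trans h; rewrite le_eqVlt; apply/orP;
  left; apply/eqP; ring.
Qed.

(* Infimal convolution with [L * norm1] makes the domain the whole space
   without lowering the value at the origin below [c]. *)
Lemma support_of_calm K (c L : R) : convex_rel K -> 0 <= L ->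
  (forall z a, K z a -> c - L * norm1 z <= a) ->
  exists y, forall z a, K z a -> c + dot y z <= a.
Proof.
move=> cK L0 calm.
have [[w0 [a0 Kw0]]|Ke] := pselect (exists z a, K z a); last first.
  by exists 0 => z a Kz; exfalso; apply: Ke; exists z, a.
pose K' z b := exists w a, K w a /\ a + L * norm1 (z - w) <= b.
have [|||y hy] := @support_at_core K' c.
- move=> z b z' b' s s01 [w [a [Kw wb]]] [w' [a' [Kw' wb']]].
  have [s0 s1] := andP s01.
  exists ((1 - s) *: w + s *: w'), ((1 - s) * a + s * a'); split; first exact: cK.
  have -> : (1 - s) *: z + s *: z' - ((1 - s) *: w + s *: w') =
            (1 - s) *: (z - w) + s *: (z' - w').
    by rewrite !scalerBr opprD addrACA.
  have N : norm1 ((1 - s) *: (z - w) + s *: (z' - w')) <=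
           (1 - s) * norm1 (z - w) + s * norm1 (z' - w').
    apply: le_trans (norm1D _ _) _.
    by rewrite !norm1Z (gtr0_norm s0) gtr0_norm// subr_gt0.
  have {}N := ler_wpM2l L0 N.
  have h1 : (1 - s) * (a + L * norm1 (z - w)) <= (1 - s) * b.
    by rewrite ler_wpM2l// subr_ge0 ltW.
  have h2 : s * (a' + L * norm1 (z' - w')) <= s * b' by rewrite ler_wpM2l// ltW.
  lra.
- move=> b [w [a [Kw]]]; rewrite sub0r norm1N => h.
  by apply: le_trans h; rewrite -lerBlDr; exact: calm.
- move=> z b _; exists 1 => //; exists (a0 + L * norm1 (- (1 *: z) - w0)).
  by exists w0, a0.
exists y => z a Kz; apply: hy; exists z, a; split => //.
by rewrite subrr norm1_0 mulr0 addr0.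
Qed.

(* An affine minorant turns the bound on the ball into calmness at [x0]:
   outside the ball it dominates a steep enough downward cone. *)
Lemma support_of_local_bound K (x0 : 'rV[R]_p) (alpha r : R) : convex_rel K ->
  (exists z a, K z a) -> (forall z, exists M, forall a, K z a -> M <= a) ->
  0 < r -> (forall z a, K z a -> norm1 (z - x0) < r -> alpha <= a) ->
  exists y, forall z a, K z a -> alpha + dot y (z - x0) <= a.
Proof.
move=> cK Kne bK r0 near.
have [y0 [c hy0]] := exists_affine_minorant _ cK Kne bK.
(* The first term pays for the slope of the affine minorant, the second for its gap to [alpha] at
   [x0], since [norm1 u >= r] outside the ball. *)
pose L := norm1 y0 + `|alpha - (c + dot y0 x0)| / r.
have L0 : 0 <= L by rewrite addr_ge0 ?norm1_ge0// divr_ge0// ltW.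
have [|||y hy] := @support_of_calm (fun u a => K (u + x0) a) alpha L.
- move=> z a z' a' s s01 Kz Kz'; have := cK _ _ _ _ _ s01 Kz Kz'.
  congr (K _ _); rewrite !scalerDr addrACA -scalerDl subrK scale1r //.
- by [].
- move=> u a Ku; have [ur|ru] := ltP (norm1 u) r.
    apply: le_trans (near _ _ Ku _); last by rewrite addrK.
    by rewrite lerBlDr lerDl mulr_ge0// norm1_ge0.
  apply: le_trans (hy0 _ _ Ku); rewrite dotDr /L mulrDl.
  have := dot_le_norm1 y0 u; rewrite ler_norml => /andP[h _].
  have h2 : `|alpha - (c + dot y0 x0)| <= `|alpha - (c + dot y0 x0)| / r * norm1 u.
    by rewrite -mulrA ler_peMr// mulrC ler_pdivlMr// mul1r.
  have := ler_norm (alpha - (c + dot y0 x0)).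
  lra.
by exists y => z a Kz; apply: hy; rewrite subrK.
Qed.

End ConvexRelations.

(** * Elimination of variables from piecewise linear-quadratic epigraphs *)

Section QuadraticDescent.
Context {R : realType}.
Implicit Types (cs : seq (R * R)) (t : R).

Let feasible cs t := all (fun c => c.1 * t + c.2 <= 0) cs.

(** Constraints are added one at a time. If the new one fails at the current end, the segment is cut
    at its root; the earlier ones, being affine and valid at both ends, still hold there. *)
Lemma segment_blocking cs t0 t1 : feasible cs t0 ->
  exists theta, [/\ 0 <= theta <= 1, feasible cs (t0 + theta * (t1 - t0))
    & t0 + theta * (t1 - t0) = t1 \/
      exists2 c, c \in cs & t0 + theta * (t1 - t0) = - c.2 / c.1].
Proof.
elim: cs => [_|c cs IH /= /andP[c0 cs0]].
  by exists 1; split; [rewrite ler01 lexx|by []|left; ring].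
have [th [th01 fth blk]] := IH cs0; have [th0 th1] := andP th01.
have [cth|cth] := leP (c.1 * (t0 + th * (t1 - t0)) + c.2) 0.
  exists th; split => //; first by rewrite cth.
  by case: blk => [|[c' c'cs ?]]; [left|right; exists c' => //; rewrite inE c'cs orbT].
(* The new constraint reads [A + theta * B] along the segment, hence the root [- A / B]. *)
pose A := c.1 * t0 + c.2; pose B := c.1 * (t1 - t0).
have BE : c.1 * (t0 + th * (t1 - t0)) + c.2 = A + th * B by rewrite /A /B; ring.
rewrite BE in cth; rewrite -/A in c0.
have thB : 0 < th * B by lra.
have thp : 0 < th by rewrite lt_neqAle th0 andbT; apply: contraTneq thB => <-;
  rewrite mul0r ltxx.
have Bp : 0 < B by rewrite -(pmulr_rgt0 _ thp).
have thB' : - A / B < th by rewrite ltr_pdivrMr//; lra.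
have thA : 0 <= - A / B by rewrite divr_ge0 ?oppr_ge0// ltW.
have c1 : c.1 != 0 by apply: contraTneq Bp => c1; rewrite /B c1 mul0r ltxx.
have t10 : t1 - t0 != 0 by apply: contraTneq Bp => t10; rewrite /B t10 mulr0 ltxx.
have rootE : t0 + - A / B * (t1 - t0) = - c.2 / c.1.
  by rewrite /A /B; field; rewrite t10 c1.
exists (- A / B); split.
- by rewrite thA (le_trans (ltW thB')).
- apply/andP; split; first by rewrite rootE mulrCA divff// mulr1 addNr.
  apply/allP => c' c'cs; have := allP cs0 _ c'cs; have := allP fth _ c'cs => /=.
  set X := - A / B in thB' thA *; move=> h1 h0.
  rewrite -(pmulr_rle0 _ thp).
  have -> : th * (c'.1 * (t0 + X * (t1 - t0)) + c'.2) =
    (th - X) * (c'.1 * t0 + c'.2) + X * (c'.1 * (t0 + th * (t1 - t0)) + c'.2) by ring.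
  by rewrite -[leRHS]addr0 lerD// mulr_ge0_le0// subr_ge0 ltW.
- by right; exists c => //; rewrite inE eqxx.
Qed.

(* From [t0] one walks downhill until a constraint blocks, the vertex of the
   parabola is met, or for ever.  As [x / 0 = 0], degenerate candidates are
   harmless. *)
Lemma quadratic_descent cs (k b a t0 : R) : feasible cs t0 ->
  let Q t := k + t * b + t ^+ 2 * a in
  (exists t, [/\ feasible cs t, Q t <= Q t0
     & [\/ t = 0, t = - b / (2 * a) | exists2 c, c \in cs & t = - c.2 / c.1]]) \/
  (exists sigma C eps, 0 < eps /\ forall t, 0 <= t ->
     feasible cs (t0 + sigma * t) /\ Q (t0 + sigma * t) <= C - eps * t).
Proof.
move=> f0 Q.
(* A walk to an infeasible target stops at the root of a constraint; a walk to a candidate stops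
   there or at such a root. *)
have walk t1 : (forall th, 0 <= th <= 1 -> Q (t0 + th * (t1 - t0)) <= Q t0) ->
    ~~ feasible cs t1 \/ t1 = 0 \/ t1 = - b / (2 * a) ->
  exists t, [/\ feasible cs t, Q t <= Q t0
     & [\/ t = 0, t = - b / (2 * a) | exists2 c, c \in cs & t = - c.2 / c.1]].
  move=> down t1E; have [th [th01 fth blk]] := segment_blocking _ _ t1 f0.
  exists (t0 + th * (t1 - t0)); split => //; first exact: down.
  case: blk => [tE|]; last by constructor 3.
  rewrite tE in fth *; case: t1E => [|[]];
    [by rewrite fth|by constructor 1|by constructor 2].
have [a0|a0|a0] := ltgtP a 0; last first.
(* For [a = 0] and [b != 0], the direction [- b] descends at rate [b ^+ 2]. *)
- have [b0|b0] := eqVneq b 0.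
    left; apply: (walk 0); last by right; left.
    by move=> th _; rewrite /Q a0 b0 !mulr0 lexx.
  have [[t1 [t1p t1f]]|noblock] := pselect (exists t, 0 <= t /\ ~~ feasible cs (t0 + (- b) * t)).
    left; apply: (walk (t0 + (- b) * t1)); last by left.
    move=> th /andP[th0 _]; rewrite /Q a0 !mulr0 !addr0 -subr_ge0.
    rewrite (_ : _ - _ = (th * t1) * b ^+ 2); last by ring.
    by rewrite mulr_ge0 ?sqr_ge0// mulr_ge0.
  right; exists (- b), (Q t0), (b ^+ 2); split;
    first by rewrite lt_neqAle eq_sym sqrf_eq0 b0 sqr_ge0.
  move=> t t_ge0; split.
    by apply/negPn/negP => tf; apply: noblock; exists t.
  by rewrite /Q a0 !mulr0 !addr0 le_eqVlt; apply/orP; left; apply/eqP; ring.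
- left; apply: (walk (- b / (2 * a))); last by right; right.
  move=> th /andP[th0 th1]; rewrite /Q -subr_ge0.
  have an : a != 0 by rewrite gt_eqF.
  set v := - b / (2 * a).
  have -> : b = - (2 * a * v) by rewrite /v; field.
  rewrite (_ : _ - _ = a * (th * (2 - th)) * (v - t0) ^+ 2); last by ring.
  by rewrite mulr_ge0 ?sqr_ge0// mulr_ge0 ?(ltW a0)// mulr_ge0//; lra.
(* For [a < 0], [D] is the derivative of [Q] at [t0]; by concavity a walk that starts without ascent
   goes downhill for ever. *)
- pose D := b + 2 * a * t0.
  pose sigma : R := if 0 < D then -1 else 1.
  have sD : sigma * D <= 0 by rewrite /sigma; case: ltP => D0; lra.
  have s2 : sigma ^+ 2 = 1 by rewrite /sigma; case: ifP => _; ring.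
  have QE t : Q (t0 + sigma * t) = Q t0 + t * (sigma * D) + t ^+ 2 * a.
    have -> : t ^+ 2 * a = t ^+ 2 * sigma ^+ 2 * a by rewrite s2 mulr1.
    by rewrite /Q /D; ring.
  have [[t1 [t1p t1f]]|noblock] := pselect (exists t, 0 <= t /\ ~~ feasible cs (t0 + sigma * t)).
    left; apply: (walk (t0 + sigma * t1)); last by left.
    move=> th /andP[th0 _].
    have -> : t0 + th * (t0 + sigma * t1 - t0) = t0 + sigma * (th * t1) by ring.
    have tp : 0 <= th * t1 by rewrite mulr_ge0.
    by rewrite QE -addrA gerDl -[leRHS]addr0 lerD // mulr_ge0_le0 ?sqr_ge0 ?(ltW a0).
  (* From [(t - 1) ^+ 2 * a <= 0], the term [t ^+ 2 * a] is at most [2 * a * t - a]. *)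
  right; exists sigma, (Q t0 - a), (- 2 * a); split; first by lra.
  move=> t t_ge0; split.
    by apply/negPn/negP => tf; apply: noblock; exists t.
  rewrite QE.
  have h1 : t * (sigma * D) <= 0 by rewrite mulr_ge0_le0.
  have h2 : (t - 1) ^+ 2 * a <= 0 by rewrite mulr_ge0_le0 ?sqr_ge0 ?(ltW a0).
  have -> : Q t0 + t * (sigma * D) + t ^+ 2 * a =
    t * (sigma * D) + (t - 1) ^+ 2 * a + (Q t0 - a - (-2 * a) * t) by ring.
  by rewrite gerDr -[leRHS]addr0 lerD.
Qed.

End QuadraticDescent.

(** * Piecewise linear-quadratic relations: local bounds, calmness, projections *)

Section PiecewiseLinearQuadraticRelations.
Context {R : realType} {p : nat}.
Local Notation V := 'rV[R]_p.
Implicit Types (K : V -> R -> Prop) (z d : V).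

Definition affine_eval (c : V * R) z : R := dot c.1 z + c.2.

Definition affine_fun (l : V -> R) := exists c, l = affine_eval c.

(** This form makes stability under substituting [z + l z *: d], with [l] affine, a plain
    induction. *)
Inductive quadratic : (V -> R) -> Prop :=
| quadratic_mul l l' : affine_fun l -> affine_fun l' ->
    quadratic (fun z => l z * l' z)
| quadratic_add q q' : quadratic q -> quadratic q' ->
    quadratic (fun z => q z + q' z).

(** Pieces may overlap with different quadratics: a union stands for a pointwise minimum, which is
    what eliminating a variable produces. *)
Inductive plq : (V -> R -> Prop) -> Prop :=
| plq_empty : plq (fun _ _ => False)
| plq_piece (cs : seq (V * R)) q : quadratic q ->
    plq (fun z a => all (fun c => affine_eval c z <= 0) cs /\ q z <= a)
| plq_union K K' : plq K -> plq K' -> plq (fun z a => K z a \/ K' z a).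

Lemma affine_eval_line c z d t :
  affine_eval c (z + t *: d) = dot c.1 d * t + affine_eval c z.
Proof. by rewrite /affine_eval dotDr dotZr; ring. Qed.

Lemma affine_fun_lin l l' (r s : R) : affine_fun l -> affine_fun l' ->
  affine_fun (fun z => r * l z + s * l' z).
Proof.
move=> [c ->] [c' ->]; exists (r *: c.1 + s *: c'.1, r * c.2 + s * c'.2).
by apply/funext => z; rewrite /affine_eval/= dotDl !dotZl; ring.
Qed.

Lemma affine_fun_cst (r : R) : affine_fun (fun=> r).
Proof. by exists (0, r); apply/funext => z; rewrite /affine_eval/= dot0l add0r. Qed.

Lemma quadratic_sum (T : Type) (s : seq T) (q : T -> V -> R) :
  (forall j, quadratic (q j)) -> quadratic (fun z => \sum_(j <- s) q j z).
Proof.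
move=> quad; elim: s => [|j s IH].
  rewrite (_ : (fun _ => _) = (fun z => 0 * 0)).
    by apply: (quadratic_mul (fun=> 0) (fun=> 0)); exact: affine_fun_cst.
  by apply/funext => z; rewrite big_nil mul0r.
rewrite (_ : (fun _ => _) = (fun z => q j z + \sum_(j <- s) q j z)).
  exact: quadratic_add.
by apply/funext => z; rewrite big_cons.
Qed.

Lemma affine_fun_shift l c d : affine_fun l ->
  affine_fun (fun z => l (z + affine_eval c z *: d)).
Proof.
move=> [c' ->].
have -> : (fun z => affine_eval c' (z + affine_eval c z *: d)) =
    (fun z => dot c'.1 d * affine_eval c z + 1 * affine_eval c' z).
  by apply/funext => z; rewrite affine_eval_line mul1r.
by apply: affine_fun_lin; [exists c|exists c'].
Qed.

Lemma quadratic_shift q c d : quadratic q ->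
  quadratic (fun z => q (z + affine_eval c z *: d)).
Proof.
elim=> [l l' al al'|q1 q2 _ h1 _ h2]; last exact: quadratic_add.
by apply: (quadratic_mul (fun z => l (z + affine_eval c z *: d))
  (fun z => l' (z + affine_eval c z *: d))); apply: affine_fun_shift.
Qed.

(** Since [a] does not depend on [z] and [b] is affine, the vertex [- b z / (2 * a)] is again affine
    in [z]. *)
Lemma quadratic_line q d : quadratic q ->
  exists b a, affine_fun b /\
    forall z t, q (z + t *: d) = q z + t * b z + t ^+ 2 * a.
Proof.
elim=> [l l' [c ->] [c' ->]|q1 q2 _ [b1 [a1 [A1 h1]]] _ [b2 [a2 [A2 h2]]]].
  exists (fun z => dot c'.1 d * affine_eval c z + dot c.1 d * affine_eval c' z).
  exists (dot c.1 d * dot c'.1 d); split.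
    by apply: affine_fun_lin; [exists c|exists c'].
  by move=> z t; rewrite !affine_eval_line; ring.
exists (fun z => 1 * b1 z + 1 * b2 z), (a1 + a2); split; first exact: affine_fun_lin.
by move=> z t; rewrite h1 h2; ring.
Qed.

Lemma quadratic_ge_near q z0 : quadratic q ->
  exists2 L, 0 <= L & forall z, norm1 (z - z0) <= 1 ->
    q z0 - L * norm1 (z - z0) <= q z.
Proof.
elim=> [l l' [c ->] [c' ->]|q1 q2 _ [L1 L10 h1] _ [L2 L20 h2]]; last first.
  by exists (L1 + L2) => [|z z1]; [exact: addr_ge0|have := h1 z z1; have := h2 z z1;
    lra].
pose u := affine_eval c z0; pose u' := affine_eval c' z0.
pose Y := norm1 c.1; pose Y' := norm1 c'.1.
have Y0 : 0 <= Y by exact: norm1_ge0.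
have Y'0 : 0 <= Y' by exact: norm1_ge0.
exists (`|u| * Y' + `|u'| * Y + Y * Y').
  by rewrite !addr_ge0// mulr_ge0.
move=> z z1; set N := norm1 _ in z1 *.
have N0 : 0 <= N by exact: norm1_ge0.
have E c0 : affine_eval c0 z = affine_eval c0 z0 + dot c0.1 (z - z0).
  by rewrite /affine_eval dotDr dotNr; ring.
rewrite !E -/u -/u'.
have := dot_le_norm1 c.1 (z - z0); have := dot_le_norm1 c'.1 (z - z0).
rewrite -/N -/Y -/Y'; set v := dot c.1 _; set v' := dot c'.1 _ => hv' hv.
have h1 : `|u * v'| <= `|u| * (Y' * N) by rewrite normrM ler_wpM2l.
have h2 : `|u' * v| <= `|u'| * (Y * N) by rewrite normrM ler_wpM2l.
have h3 : `|v * v'| <= (Y * N) * (Y' * N) by rewrite normrM ler_pM.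
have h4 : (Y * N) * (Y' * N) <= Y * Y' * N.
  rewrite (_ : _ * _ = (Y * Y' * N) * N); last by ring.
  by apply: ler_piMr => //; rewrite !mulr_ge0.
move: h1 h2 h3; rewrite !ler_norml => /andP[h1 _] /andP[h2 _] /andP[h3 _].
lra.
Qed.

Lemma plq_ext K K' : (forall z a, K z a <-> K' z a) -> plq K -> plq K'.
Proof. by move=> KK'; rewrite (_ : K = K')//; apply/funext => z; apply/funext => a;
  apply/propext. Qed.

Lemma plq_bigU (T : eqType) (s : seq T) (K : T -> V -> R -> Prop) :
  (forall x, plq (K x)) -> plq (fun z a => exists2 x, x \in s & K x z a).
Proof.
move=> plqK; elim: s => [|x s IH].
  by apply: plq_ext plq_empty => z a; split => // -[].
apply: plq_ext (plq_union _ _ (plqK x) IH) => z a; split.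
  case=> [Kx|[x' x's Kx']]; first by exists x; rewrite ?inE ?eqxx.
  by exists x' => //; rewrite inE x's orbT.
by case=> x'; rewrite inE => /predU1P[->|x's]; [left|right; exists x'].
Qed.

(** A failure at [s = 0] is a strict inequality, which persists for small [s]; a union takes the
    smaller threshold. *)
Lemma plq_line_closed K z w (alpha beta : R) : plq K ->
  (forall s, 0 < s < 1 -> K (z + s *: w) (alpha + s * beta)) -> K z alpha.
Proof.
move=> plqK Kline; apply: contrapT => nK.
suff [e /andP[e0 e1] he] : exists2 e, 0 < e <= 1 &
    forall s, 0 < s < e -> ~ K (z + s *: w) (alpha + s * beta).
  by apply: (he (e / 2)) => //; [|apply: Kline]; apply/andP; split; lra.
(* A quantity positive at [0] and bounded below by a linear function stays positive. *)
have pos (g : R -> R) (M A : R) : 0 < M -> 0 <= A ->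
    (forall s, 0 < s < 1 -> M - s * A <= g s) ->
    exists2 e, 0 < e <= 1 & forall s, 0 < s < e -> 0 < g s.
  move=> M0 A0 gM; exists (M / (M + A + 1)).
    have ? : 0 < M + A + 1 by lra.
    by rewrite divr_gt0//= ler_pdivrMr//; lra.
  move=> s /andP[s0]; rewrite ltr_pdivlMr; last by lra.
  move=> sM; have sA : 0 <= s * A by rewrite mulr_ge0// ltW.
  have sM' : 0 < s * M by rewrite mulr_gt0.
  have s1 : s < 1 by rewrite -(ltr_pM2r M0); lra.
  by apply: lt_le_trans (gM _ _); [lra|rewrite s0].
elim: plqK nK {Kline} => [_|cs q quad nK|K1 K2 _ h1 _ h2 /not_orP[/h1[e1 e10 {}h1] /h2[e2 e20 {}h2]]].
- by exists 1 => [|s _ []]; rewrite ltr01 lexx.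
- have [/allP cz|] := boolP (all (fun c => affine_eval c z <= 0) cs); last first.
    move=> /allPn[c ccs]; rewrite -ltNge => cz.
    have [|s s01|e e01 he] := pos (fun s => affine_eval c (z + s *: w)) (affine_eval c z) `|dot c.1 w| cz.
    + by [].
    + have [s0 _] := andP s01.
      have : s * - dot c.1 w <= s * `|dot c.1 w| by rewrite ler_wpM2l ?(ltW s0)// -normrN ler_norm.
      by rewrite affine_eval_line; lra.
    by exists e => // s /he; rewrite ltNge => /negP cs0 [/allP/(_ _ ccs)].
  have qz : alpha < q z by rewrite ltNge; apply/negP => qz; apply: nK; split => //;
    exact/allP.
  have [b [a [_ qline]]] := quadratic_line _ w quad.
  have [||s s01|e e01 he] := pos (fun s => q (z + s *: w) - (alpha + s * beta)) (q z - alpha) (`|b z - beta| + `|a|).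
  + by rewrite subr_gt0.
  + by rewrite addr_ge0.
  + have [s0 s1] := andP s01.
    have h1 : s * - (b z - beta) <= s * `|b z - beta| by rewrite ler_wpM2l ?(ltW s0)// -normrN ler_norm.
    have h2 : s ^+ 2 * - a <= s ^+ 2 * `|a| by rewrite ler_wpM2l ?sqr_ge0// -normrN ler_norm.
    have h3 : s ^+ 2 * `|a| <= s * `|a| by rewrite ler_wpM2r// expr2 ler_piMr ?ltW.
    by rewrite qline; lra.
  by exists e => // s /he; rewrite subr_gt0 ltNge => /negP qs0 [].
- have [[e1p e11] [e2p e21]] := (andP e10, andP e20).
  exists (Num.min e1 e2); first by rewrite lt_min e1p e2p ge_min e11.
  by move=> s; rewrite lt_min => /and3P[s0 s1 s2] [/(h1 s)|/(h2 s)]; apply; rewrite s0.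
Qed.

(** A piece whose constraints hold at [z0] is handled by [quadratic_ge_near]; any other one misses a
    ball around [z0]. *)
Lemma plq_ge_near K z0 (c : R) : plq K -> (forall a, K z0 a -> c <= a) ->
  exists r L, [/\ 0 < r, 0 <= L & forall z a, K z a -> norm1 (z - z0) < r ->
    c - L * norm1 (z - z0) <= a].
Proof.
elim=> [_|cs q quad cK|K1 K2 _ h1 _ h2 cK]; first by exists 1, 0; rewrite lexx.
- have [cz0|] := boolP (all (fun c => affine_eval c z0 <= 0) cs); last first.
    move=> /allPn[c' ccs]; rewrite -ltNge => c'z0.
    have dn : 0 < norm1 c'.1 + 1 by rewrite ltr_wpDl ?norm1_ge0.
    exists (affine_eval c' z0 / (norm1 c'.1 + 1)), 0; split => //.
      by rewrite divr_gt0.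
    move=> z a [/allP /(_ _ ccs) c'z _]; rewrite ltr_pdivlMr// => zr; exfalso.
    have := dot_le_norm1 c'.1 (z - z0); rewrite ler_norml dotDr dotNr => /andP[h _].
    have N0 := norm1_ge0 (z - z0).
    by move: c'z c'z0 zr h; rewrite /affine_eval; lra.
  have [L L0 hL] := quadratic_ge_near _ z0 quad.
  exists 1, L; split => // z a [_ qa] z1; apply: le_trans qa.
  apply: le_trans (hL _ (ltW z1)); rewrite lerD2r; exact: cK.
- have [|r1 [L1 [r10 L10 {}h1]]] := h1; first by move=> a Ka; apply: cK; left.
  have [|r2 [L2 [r20 L20 {}h2]]] := h2; first by move=> a Ka; apply: cK; right.
  exists (Num.min r1 r2), (L1 + L2); split; [by rewrite lt_min r10|exact: addr_ge0|].
  move=> z a Kz; rewrite lt_min => /andP[zr1 zr2]; have N0 := norm1_ge0 (z - z0).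
  have := mulr_ge0 L10 N0; have := mulr_ge0 L20 N0.
  by case: Kz => [/h1/(_ zr1)|/h2/(_ zr2)]; lra.
Qed.

(** Convexity makes the local bound global: [z] is contracted into the ball by combining it with a
    point over the origin of height nearly [c]. *)
Lemma plq_calm K (c : R) : plq K -> convex_rel K ->
  (forall a, K 0 a -> c <= a) -> (forall e, 0 < e -> exists2 a, a < c + e & K 0 a) ->
  exists2 L, 0 <= L & forall z a, K z a -> c - L * norm1 z <= a.
Proof.
move=> plqK cK cK0 Kc; have [r [L [r0 L0 hL]]] := plq_ge_near _ _ _ plqK cK0.
exists L => // z a Kz; have N0 := norm1_ge0 z.
pose s := r / (r + norm1 z + 1).
have den : 0 < r + norm1 z + 1 by lra.
have s0 : 0 < s by rewrite divr_gt0.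
have s1 : s < 1 by rewrite ltr_pdivrMr//; lra.
have sN : s * norm1 z < r.
  by rewrite mulrAC ltr_pdivrMr// ltr_pM2l//; lra.
apply/ler_addgt0Pr => e e0.
(* The slack is [s * e] because the final inequality is divided by [s]. *)
have [a0 a0e Ka0] := Kc (s * e) (mulr_gt0 s0 e0).
have s01 : 0 < s < 1 by rewrite s0.
have := hL _ _ (cK _ _ _ _ _ s01 Ka0 Kz).
rewrite scaler0 add0r subr0 norm1Z gtr0_norm// => /(_ sN) h.
rewrite -(ler_pM2l s0).
have h2 : (1 - s) * a0 <= a0 - s * c.
  rewrite mulrBl mul1r lerD2l lerN2 ler_pM2l//; exact: cK0.
lra.
Qed.

Definition proj_dir d K z (a : R) := exists t, K (z + t *: d) a.

Definition descent_ray d K := exists z sigma (C eps : R), 0 < eps /\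
  forall t, 0 <= t -> K (z + (sigma * t) *: d) (C - eps * t).

(** By [quadratic_descent] it suffices to test finitely many positions on each line. They are affine
    in [z], so substituting each of them yields one piece. *)
Lemma plq_proj_dir d K : plq K -> ~ descent_ray d K -> plq (proj_dir d K).
Proof.
elim=> [_|cs q quad noray|K1 K2 _ h1 _ h2 noray]; last first.
- apply: plq_ext (plq_union _ _ (h1 _) (h2 _)).
  + move=> z a; split => [[[t Kt]|[t Kt]]|[t [Kt|Kt]]].
    * by exists t; left.
    * by exists t; right.
    * by left; exists t.
    * by right; exists t.
  + move=> [z [sg [C [e [e0 h]]]]]; apply: noray; exists z, sg, C, e; split => // t t0.
    by left; apply: h.
  + move=> [z [sg [C [e [e0 h]]]]]; apply: noray; exists z, sg, C, e; split => // t t0.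
    by right; apply: h.
- have [b [a [[c0 bE] qline]]] := quadratic_line _ d quad; subst b.
  pose neg_div (c : V * R) (r : R) : V * R := (- r^-1 *: c.1, - c.2 / r).
  have neg_divE c r z : affine_eval (neg_div c r) z = - affine_eval c z / r.
    by rewrite /affine_eval/= dotZl; ring.
  pose cands : seq (V * R) :=
    [:: (0, 0), neg_div c0 (2 * a) & [seq neg_div c (dot c.1 d) | c <- cs]].
  have := @plq_bigU _ cands (fun tau z e =>
    all (fun c => affine_eval c (z + affine_eval tau z *: d) <= 0) cs /\
    q (z + affine_eval tau z *: d) <= e).
  move=> H; apply: (plq_ext _ _ _ (H _)); last first.
    move=> tau; have aff c : {c' | (fun z =>
      affine_eval c (z + affine_eval tau z *: d)) = affine_eval c'}.
      by apply: cid; apply: affine_fun_shift; exists c.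
    apply: plq_ext (plq_piece [seq sval (aff c) | c <- cs] _ (quadratic_shift _ tau d quad)) => z e.
    rewrite all_map; have -> // : all (preim (fun c => sval (aff c)) (fun c =>
      affine_eval c z <= 0)) cs =
      all (fun c => affine_eval c (z + affine_eval tau z *: d) <= 0) cs.
    by apply: eq_all => c /=; rewrite -(svalP (aff c)).
  move=> z e; split => [[tau _ h]|[t [ft qt]]]; first by exists (affine_eval tau z).
  pose cz := [seq (dot c.1 d, affine_eval c z) | c <- cs].
  have feasE u : all (fun c => c.1 * u + c.2 <= 0) cz =
      all (fun c => affine_eval c (z + u *: d) <= 0) cs.
    by rewrite all_map; apply: eq_all => c /=; rewrite affine_eval_line.
  have [|[u [fu Qu uE]]|[sg [C [eps [eps0 h]]]]] :=
      @quadratic_descent R cz (q z) (affine_eval c0 z) a t.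
  + by rewrite feasE.
  + rewrite -!qline in Qu; rewrite feasE in fu.
    suff [tau tauc uE'] : exists2 tau, tau \in cands & u = affine_eval tau z.
      by exists tau => //; rewrite -uE'; split => //; exact: le_trans qt.
    case: uE => [->|->|[_ /mapP[c ccs ->] ->]].
    * by exists (0, 0); rewrite ?inE ?eqxx// /affine_eval dot0l addr0.
    * by exists (neg_div c0 (2 * a)); rewrite ?inE ?eqxx ?orbT ?neg_divE.
    * exists (neg_div c (dot c.1 d)); rewrite ?neg_divE// !inE; apply/orP; right.
      by apply/orP; right; apply/mapP; exists c.
  + exfalso; apply: noray; exists (z + t *: d), sg, C, eps; split => // u u0.
    have [] := h _ u0; rewrite -qline feasE scalerDl addrA => fu qu.
    by split.
- by apply: plq_ext plq_empty => z a; split => // -[].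
Qed.

(* The direction of the ray is a recession direction of [K], so it may be
   followed from any point. *)
Lemma descent_ray_unbounded d K : plq K -> convex_rel K -> descent_ray d K ->
  exists2 eps, 0 < eps & forall z a, K z a -> forall t, 0 <= t ->
    proj_dir d K z (a - eps * t).
Proof.
move=> plqK cK [z0 [sg [C [eps [eps0 ray]]]]]; exists eps => // z a Kz t t0.
(* Combining [(z, a)] with the ray at parameter [t / s], with weights [1 - s] and [s], keeps the
   displacement [sg * t] and the drop [eps * t]; then [s] tends to 0. *)
exists (sg * t); apply: (@plq_line_closed K _ (z0 - z) _ (C - a) plqK) => s s01.
have [s0 s1] := andP s01.
have ts : 0 <= t / s by rewrite divr_ge0// ltW.
have := cK _ _ _ _ _ s01 Kz (ray _ ts).
have sn : s != 0 by rewrite gt_eqF.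
congr (K _ _); last by field.
apply/rowP => i; rewrite !mxE; by field.
Qed.

Definition proj_dirs (ds : seq V) K := foldl (fun K d => proj_dir d K) K ds.

Lemma proj_dirs_mono ds K K' (e : R) : (forall z a, K z a -> K' z (a + e)) ->
  forall z a, proj_dirs ds K z a -> proj_dirs ds K' z (a + e).
Proof.
elim: ds K K' => [//|d ds IH] K K' KK' z a /=; apply: IH => {}z {}a [t Kt].
by exists t; apply: KK'.
Qed.

Lemma convex_rel_proj_dir d K : convex_rel K -> convex_rel (proj_dir d K).
Proof.
move=> cK z a z' a' s s01 [t Kt] [t' Kt']; exists ((1 - s) * t + s * t').
have := cK _ _ _ _ _ s01 Kt Kt'; congr (K _ _).
by apply/rowP => i; rewrite !mxE; ring.
Qed.

(** A descent ray at any stage could be followed from points over [z0], so a lower bound at this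
    single point permits every elimination. *)
Lemma plq_proj_dirs ds K z0 (c : R) : plq K -> convex_rel K ->
  (exists a, proj_dirs ds K z0 a) -> (forall a, proj_dirs ds K z0 a -> c <= a) ->
  plq (proj_dirs ds K).
Proof.
elim: ds K => [//|d ds IH] K plqK cK [a0 Ka0] cK0 /=.
apply: IH => //; [|exact: convex_rel_proj_dir|by exists a0].
apply: plq_proj_dir => // /(descent_ray_unbounded _ _ plqK cK)[eps eps0 down].
(* Chosen so that [a0 - eps * t < c]. *)
pose t := (`|a0 - c| + 1) / eps.
have t0 : 0 <= t by rewrite divr_ge0 ?(ltW eps0)// addr_ge0.
suff /cK0 : proj_dirs (d :: ds) K z0 (a0 + - (eps * t)).
  rewrite /t mulrCA divff ?gt_eqF// mulr1.
  by have := ler_norm (a0 - c); lra.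
move: Ka0; apply: (proj_dirs_mono ds (proj_dir d K)) => z a [u Ku].
have [u' Ku'] := down _ _ Ku _ t0.
by exists (u + u'); rewrite scalerDl addrA.
Qed.

Lemma convex_rel_proj_dirs ds K : convex_rel K -> convex_rel (proj_dirs ds K).
Proof. by elim: ds K => [//|d ds IH] K cK /=; apply/IH/convex_rel_proj_dir. Qed.

Lemma proj_dirs_shift (I : Type) (s : seq I) (D : I -> V) (x : I -> R) K z a :
  K (z + \sum_(i <- s) x i *: D i) a -> proj_dirs [seq D i | i <- s] K z a.
Proof.
elim: s K z => [|i s IH] K z; first by rewrite big_nil addr0.
rewrite big_cons => Kz /=; apply: IH; exists (x i).
by rewrite -addrA (addrC (\sum_(_ <- _) _)).
Qed.

Lemma proj_dirsE (P : V -> Prop) ds K z a : P 0 ->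
  (forall w t d, P w -> d \in ds -> P (w + t *: d)) ->
  proj_dirs ds K z a -> exists2 w, P w & K (z + w) a.
Proof.
move=> P0; elim: ds K => [K _ Kz|d ds IH K Pd h]; first by exists 0; rewrite ?addr0.
have [w t d' Pw d'ds|w Pw [t Kt]] := IH _ _ h.
  by apply: Pd; rewrite ?inE ?d'ds ?orbT.
by exists (w + t *: d); rewrite ?addrA//; apply: Pd; rewrite ?inE ?eqxx.
Qed.

End PiecewiseLinearQuadraticRelations.

Local Open Scope ereal_scope.

(** * Conjugates and duality *)

Section ExtendedReals.
Context {R : realType}.
Implicit Types (x y : \bar R) (a b r : R).

Lemma lee_real_ub x y : (forall a, y <= a%:E -> x <= a%:E) -> x <= y.
Proof.
case: y => [b|_|h]; [by apply|exact: leey|].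
case: x h => [b| |] // h.
- by exfalso; have := h (b - 1)%R; rewrite leNye lee_fin => /(_ isT); lra.
- by have := h 0%R; rewrite leNye leye_eq => /(_ isT).
Qed.

Lemma fin_between x a : -oo < x -> x <= a%:E -> exists r, x = r%:E.
Proof. by case: x => // r _ _; exists r. Qed.

Lemma fin_of_lty x : -oo < x -> x < +oo -> exists r, x = r%:E.
Proof. by case: x => // r _ _; exists r. Qed.

Lemma daddE a b : (a%:E + b%:E)%dE = (a + b)%:E.
Proof. by []. Qed.

Lemma dadd_eq_fin x y r : (x + y)%dE = r%:E ->
  exists a b, [/\ x = a%:E, y = b%:E & (a + b)%R = r].
Proof. by case: x => [a||]; case: y => [b||] //; rewrite daddE => -[<-];
  exists a, b. Qed.

(** Under the dual addition a sum below a real has no [+oo] term, so both terms have real upper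
    bounds; inequalities thus reduce to real ones. *)
Lemma dadd_leP x y a : (x + y)%dE <= a%:E <->
  exists r s, [/\ x <= r%:E, y <= s%:E & (r + s <= a)%R].
Proof.
split; last first.
  move=> [r [s [xr ys rs]]]; apply: le_trans (lee_dD xr ys) _.
  by rewrite daddE lee_fin.
case: x => [b||]; case: y => [c||] //.
- by rewrite daddE lee_fin => bc; exists b, c.
- by move=> _; exists b, (a - b)%R; rewrite leNye subrKC.
- by move=> _; exists (a - c)%R, c; rewrite leNye subrK.
- by move=> _; exists a, 0%R; rewrite !leNye addr0.
Qed.

Lemma dadd_ge a b x y : a%:E <= x -> b%:E <= y -> (a + b)%:E <= (x + y)%dE.
Proof. by move=> ax bx; rewrite -daddE; apply: lee_dD. Qed.

Lemma le_dadd_fin a b x : (a%:E <= (x + b%:E)%dE) = ((a - b)%:E <= x).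
Proof.
case: x => [c||]; first by rewrite daddE !lee_fin lerBlDr.
- by rewrite daddye !leey.
- by rewrite daddNye // !leeNy_eq.
Qed.

Lemma dadd_lty x y : ((x + y)%dE < +oo) = (x < +oo) && (y < +oo).
Proof.
by case: x => [b||]; case: y => [c||] //;
  rewrite ?daddE ?daddye ?daddey ?daddNye ?daddeNy ?ltry ?ltNyr ?ltxx ?andbF.
Qed.

Lemma dadd_gtNy x y : -oo < (x + y)%dE -> y < +oo -> -oo < x.
Proof. by case: x => [b||]; case: y => [c||] //; rewrite ?ltNyr. Qed.

Lemma le_mix a b x (s : R) : (0 < s < 1)%R -> a%:E <= x -> b%:E <= x ->
  ((1 - s) * a + s * b)%:E <= x.
Proof.
move=> /andP[s0 s1]; case: x => [c| |]; rewrite ?leey// !lee_fin => ac bc.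
have : ((1 - s) * a <= (1 - s) * c)%R by rewrite ler_wpM2l// subr_ge0 ltW.
have : (s * b <= s * c)%R by rewrite ler_wpM2l// ltW.
lra.
Qed.

(** Either pair of equalities makes every term finite; the Fenchel-Young gaps and the weak duality
    gap are then nonnegative numbers with sum zero. *)
Lemma duality_gap (f g c1 c2 c : \bar R) (d e : R) :
  d%:E - (f + e%:E)%dE <= c1 -> e%:E - g <= c2 -> d%:E - (f + g)%dE <= c ->
  c <= (c1 + c2)%dE ->
  (((f + g)%dE + c)%dE = d%:E /\ c = (c1 + c2)%dE) <->
  ((g + c2)%dE = e%:E /\ ((f + e%:E)%dE + c1)%dE = d%:E).
Proof.
move=> Y1 Y2 Y c_le; split.
  move=> [/dadd_eq_fin[fg [c' [/dadd_eq_fin[a [b [fE gE fgE]]] cE dE]]]]; subst f g c.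
  move=> /esym/dadd_eq_fin[r1 [r2 [c1E c2E rc]]]; subst c1 c2.
  move: Y1 Y2; rewrite !daddE -!EFinB !lee_fin => Y1 Y2.
  by split; congr EFin; lra.
move=> [/dadd_eq_fin[b [r2 [gE c2E be]]]]; subst g c2.
move=> /dadd_eq_fin[fe [r1 [/dadd_eq_fin[a [e' [fE [e'E] fea]]] c1E fed]]];
  subst f c1 e'.
move: Y c_le; rewrite !daddE -!EFinB; case: c => // c; rewrite !daddE !lee_fin => Y cl.
by split; congr EFin; lra.
Qed.

End ExtendedReals.

(** * Closures of epigraphs, conjugates, and the passage to relations *)

Section Epigraphs.
Context {R : realType} {p : nat}.
Implicit Types (h : 'rV[R]_p -> \bar R) (v x : 'rV[R]_p).

Lemma norm1_le (u : 'rV[R]_p) : (norm1 u <= p%:R * `|u|)%R.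
Proof.
apply: (@le_trans _ _ (\sum_(i < p) `|u|)%R); last first.
  by rewrite sumr_const card_ord mulr_natl.
apply: ler_sum => i _; suff : (`|u ord0 i| <= mx_norm u)%R by [].
by rewrite mx_normrE; apply: (le_bigmax _ (fun ij : 'I_1 * 'I_p =>
  `|u ij.1 ij.2|%R) (ord0, i)).
Qed.

Lemma closure_epiP h x (a : R) : closure (epi h) (x, a) <->
  forall r, (0 < r)%R -> exists z b,
    [/\ (norm1 (z - x) < r)%R, (`|b - a| < r)%R & h z <= b%:E].
Proof.
split=> [cl r r0|cl B [[/= X Y] [/= /nbhs_ballP[e1 /= e10 X1] /nbhs_ballP[e2 /= e20 Y2] XYB]]].
  (* The factor is [p + 1], not [p], to stay positive when [p = 0]. *)
  have e0 : (0 < r / (p%:R + 1))%R by rewrite divr_gt0// ltr_wpDl.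
  have [|[z b] /= [zb [zx ba]]] := cl (ball (x : 'rV[R]_p) (r / (p%:R + 1)) `*` ball (a : R^o) r).
    exists (ball (x : 'rV[R]_p) (r / (p%:R + 1)), ball (a : R^o) r) => //=.
    by split; exact: nbhsx_ballx.
  exists z, b; split => //; last by move: ba; rewrite -ball_normE /= distrC.
  apply: le_lt_trans (norm1_le _) _.
  move: zx; rewrite -ball_normE /= distrC ltr_pdivlMr ?ltr_wpDl// => zx.
  apply: le_lt_trans zx; rewrite mulrC ler_wpM2l// lerDl//.
have [|z [b [zx ba hz]]] := cl (Num.min e1 e2); first by rewrite lt_min e10.
move: zx ba; rewrite !lt_min => /andP[zx _] /andP[_ ba].
exists (z, b); split => //; apply: XYB; split => /=.
  by apply: X1; rewrite -ball_normE /= distrC; apply: le_lt_trans zx;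
    exact: ler_norm_norm1.
by apply: Y2; rewrite -ball_normE /= distrC.
Qed.

(** If [z] is near [x] and [b < a + r], raising [b] to [Num.max a b] gives an epigraph point near
    [(x, a)]. *)
Lemma not_closure_epi h x (a : R) : ~ closure (epi h) (x, a) ->
  exists2 r, (0 < r)%R & forall z b, h z <= b%:E -> (norm1 (z - x) < r)%R ->
    (a + r <= b)%R.
Proof.
move=> ncl; apply: contrapT => /forall2NP H; apply: ncl; apply/closure_epiP => r r0.
have [//|/existsNP[z /existsNP[b /not_implyP[hz /not_implyP[zx /negP]]]]] := H r.
rewrite -ltNge => bar; exists z, (Num.max a b); split => //.
  by rewrite ltr_norml; case: (leP a b) => ab; apply/andP; split; lra.
by apply: le_trans hz _; rewrite lee_fin le_max lexx orbT.
Qed.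

Lemma econvexP h : econvex h <-> convex_rel (fun z a => h z <= a%:E).
Proof.
split=> [ch z a z' a' s /andP[s0 s1] hz hz'|ch].
  have s1' : (0 <= 1 - s <= 1)%R by apply/andP; split; lra.
  have := ch (z, a) (z', a') (Itv01 (proj1 (andP s1')) (proj2 (andP s1'))).
  rewrite !inE => /(_ hz hz').
  by rewrite /epi /= /conv /= /unstable.onem subKr.
apply/convex_setW => -[z a] [z' a']; rewrite !inE => hz hz' k k0 k1.
rewrite inE /epi /=.
have := ch z a z' a' (1 - k%:num)%R; rewrite subKr; apply => //.
by apply/andP; split; lra.
Qed.

Lemma conjugate_leP h v (r : R) :
  conjugate h v <= r%:E <-> forall x, (dot v x - r)%:E <= h x.
Proof.
split=> [/ereal_supP H x|H].
  have := H _ (ex_intro2 _ _ x I erefl).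
  case: (h x) => [a| |]; rewrite ?leey//.
  by rewrite -EFinB !lee_fin; lra.
apply/ereal_supP => _ [x _ <-]; have := H x.
by case: (h x) => [a| |] //; rewrite ?leNye// -EFinB !lee_fin; lra.
Qed.

Lemma conjugate_ge h v x : (dot v x)%:E - h x <= conjugate h v.
Proof. by apply: ereal_sup_ubound; exists x. Qed.

Lemma eclosed_conjugate h : eclosed (conjugate h).
Proof.
rewrite /eclosed -[X in closed X](_ : closure (epi (conjugate h)) = _);
  first exact: closed_closure.
apply/seteqP; split; last exact: subset_closure.
move=> [v a] /closure_epiP cl; apply/conjugate_leP => x /=.
(* A single point of the epigraph excludes [h x = -oo]. *)
have [v1 [b1 [_ _ /conjugate_leP/(_ x)]]] := cl 1%R ltr01.
case hx : (h x) => [s| |]; rewrite ?leey// => _.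
rewrite lee_fin lerBlDr; apply/ler_addgt0Pr => e e0.
have dn : (0 < norm1 x + 1)%R by rewrite ltr_wpDl ?norm1_ge0.
have [|v' [b [vv ba /conjugate_leP/(_ x)]]] := cl (e / (norm1 x + 1))%R.
  by rewrite divr_gt0.
rewrite hx lee_fin => h1.
have vv' := ler_pM (norm1_ge0 (v' - v)) (norm1_ge0 x) (ltW vv) (lexx _).
have := dot_le_norm1 (v' - v) x; rewrite ler_norml dotDl dotNl => /andP[h2 _].
move: ba; rewrite ltr_norml => /andP[_ h3].
have h4 : (e = e / (norm1 x + 1) * norm1 x + e / (norm1 x + 1))%R.
  by rewrite -[X in (_ + X)%R]mulr1 -mulrDr divfK// gt_eqF.
lra.
Qed.

Lemma fiber_bounded h : (forall x, -oo < h x) ->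
  forall z, exists M, forall a, h z <= a%:E -> (M <= a)%R.
Proof.
move=> hN z; have := hN z; case: (h z) => [r| |] // _.
  by exists r => a; rewrite lee_fin.
by exists 0%R => a; rewrite leye_eq.
Qed.

Lemma proper_epi_nonempty h : Defs.proper h -> exists z a, h z <= a%:E.
Proof.
move=> [[x hx] hN]; have [r hr] : exists r, h x = r%:E.
  by apply: fin_of_lty => //; rewrite ltey.
by exists x, r; rewrite hr.
Qed.

Lemma plq_epigraph h v : piecewise_linear_quadratic h ->
  plq (fun z a => h z <= (a + dot v z)%:E).
Proof.
move=> [k [P [M [q [t [polyP inP outP]]]]]].
have := @plq_bigU R _ _ (enum 'I_k) (fun i z a =>
  P i z /\ (2^-1 * dot z (z *m (M i)^T) + dot (q i) z - t i - dot v z <= a)%R).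
move=> plqU; apply: (plq_ext _ _ _ (plqU _)).
  move=> z a; split=> [[i _ [Pz qa]]|].
    by rewrite (inP _ _ Pz) lee_fin; lra.
  have [[i _ Pz]|/outP ->] := pselect ((\bigcup_(i in setT) P i) z);
    last by rewrite leye_eq.
  by rewrite (inP _ _ Pz) lee_fin => qa; exists i; [rewrite mem_enum|split=> //; lra].
move=> i; have [k' [al [be Pi]]] := polyP i.
have quad : quadratic (fun z => 2^-1 * dot z (z *m (M i)^T) + dot (q i) z - t i - dot v z)%R.
  (* The quadratic form is split by rows of the matrix; the tilt by [v] joins the affine part. *)
  rewrite (_ : (fun _ => _) = (fun z =>
      \sum_j (affine_eval (2^-1 *: delta_mx ord0 j, 0) z * affine_eval (row j (M i), 0) z) +
      affine_eval (q i - v, - t i) z * 1)%R); last first.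
    apply/funext => z; rewrite mulr1 /affine_eval /= -addrA -addrA; congr (_ + _)%R.
      rewrite {1}/dot big_distrr; apply: eq_bigr => j _ /=.
      rewrite !addr0 dotZl dot_delta mulrA; congr (_ * _)%R.
      by rewrite /dot mxE; apply: eq_bigr => j' _; rewrite !mxE mulrC.
    by rewrite dotDl dotNl; ring.
  apply: quadratic_add.
    by apply: quadratic_sum => j; apply: quadratic_mul; eexists.
  by apply: (quadratic_mul (affine_eval _) (fun=> 1%R));
    [eexists|exact: affine_fun_cst].
apply: plq_ext (plq_piece [seq (al j, - be j)%R | j <- enum 'I_k'] _ quad) => z a.
rewrite Pi all_map; split=> -[h0 ->]; split=> //.
  by move=> j; have /allP/(_ j) := h0; rewrite mem_enum /affine_eval/= subr_le0; exact.
by apply/allP => j _; rewrite /= /affine_eval/= subr_le0.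
Qed.

End Epigraphs.

(** * Weak duality, convexity of [rho], and optimality conditions *)

Section Duality.
Context {R : realType} {n m : nat}.
Variables (f0 : 'rV[R]_n -> \bar R) (F : 'rV[R]_n -> option 'rV[R]_m)
  (g : 'rV[R]_m -> \bar R).

Local Notation phi := (f0_plus_comp f0 F g).
Local Notation pert := (perturbation f0 F g).
Local Notation dobj := (dual_obj f0 F g).
Local Notation rho := (rho f0 F g).
Local Notation U := (feasible_perturbations f0 F g).
Implicit Types (v x : 'rV[R]_n) (y u w z : 'rV[R]_m).

(** An upper bound on the dual objective amounts to two affine minorants, certificates that can be
    added and averaged. *)
Lemma dual_obj_leP v y (A : R) : dobj v y <= A%:E <-> exists r s, [/\
  forall x z, F x = Some z -> (dot v x - dot y z - r)%:E <= f0 x,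
  forall w, (dot y w - s)%:E <= g w & (r + s <= A)%R].
Proof.
split=> [/dadd_leP[r [s [/conjugate_leP h1 /conjugate_leP h2 rs]]]|[r [s [h1 h2 rs]]]].
  exists r, s; split => // x z Fx; have := h1 x.
  by rewrite /f0_plus_scal /scalarization Fx le_dadd_fin addrAC.
apply/dadd_leP; exists r, s; split=> //; last by apply/conjugate_leP.
apply/conjugate_leP => x; rewrite /f0_plus_scal /scalarization.
case Fx : (F x) => [z|]; last by rewrite daddey leey.
by rewrite le_dadd_fin addrAC; apply: h1.
Qed.

(** Adding the two minorants at [z = F x] cancels [dot y z]. *)
Lemma weak_duality v y : conjugate phi v <= dobj v y.
Proof.
apply: lee_real_ub => A /dual_obj_leP[r [s [h1 h2 rs]]].
apply/conjugate_leP => x; rewrite /f0_plus_comp.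
case Fx : (F x) => [z|]; last by rewrite leey.
apply: le_trans (dadd_ge _ _ _ _ (h1 _ _ Fx) (h2 z)).
by rewrite lee_fin; lra.
Qed.

Lemma weak_duality_rho v : conjugate phi v <= rho v.
Proof. by apply/ereal_infP => _ [y _ <-]; exact: weak_duality. Qed.

Lemma rho_le v y : rho v <= dobj v y.
Proof. by apply: ereal_inf_lbound; exists y. Qed.

(** Averaging the certificates [(y, r, t)] proves this for arbitrary data; [e] is there because the
    infimum need not be attained. *)
Lemma econvex_rho : econvex rho.
Proof.
apply/econvexP => v a v' a' s s01 ra ra'; have [s0 s1] := andP s01.
apply/lee_addgt0Pr => e e0.
have : rho v < (a + e)%:E by apply: le_lt_trans ra _; rewrite lte_fin ltrDl.
move=> /ereal_inf_lt[_ [y _ <-] /ltW/dual_obj_leP[r [t [f1 g1 rt]]]].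
have : rho v' < (a' + e)%:E by apply: le_lt_trans ra' _; rewrite lte_fin ltrDl.
move=> /ereal_inf_lt[_ [y' _ <-] /ltW/dual_obj_leP[r' [t' [f1' g1' rt']]]].
apply: le_trans (rho_le _ ((1 - s) *: y + s *: y')) _; rewrite -EFinD.
apply/dual_obj_leP; exists ((1 - s) * r + s * r')%R, ((1 - s) * t + s * t')%R.
split=> [x z Fx|w|].
- apply: le_trans (le_mix _ _ _ _ s01 (f1 _ _ Fx) (f1' _ _ Fx)).
  by rewrite lee_fin !dotDl !dotZl le_eqVlt; apply/orP; left; apply/eqP; ring.
- apply: le_trans (le_mix _ _ _ _ s01 (g1 w) (g1' w)).
  by rewrite lee_fin !dotDl !dotZl le_eqVlt; apply/orP; left; apply/eqP; ring.
- have : ((1 - s) * (r + t) <= (1 - s) * (a + e))%R by rewrite ler_wpM2l// subr_ge0 ltW.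
  have : (s * (r' + t') <= s * (a' + e))%R by rewrite ler_wpM2l// ltW.
  lra.
Qed.

(** The epigraph of the conjugate is closed and contains that of [rho]. *)
Lemma conjugate_le_cl_rho v : conjugate phi v <= efun_cl rho v.
Proof.
apply/ereal_infP => _ [a cl <-].
have : closure (epi (conjugate phi)) (v, a).
  apply: closure_subset cl => -[w b]; apply: le_trans; exact: weak_duality_rho.
have /closure_id <- := eclosed_conjugate phi.
by [].
Qed.

Lemma optimality_conditions v x y :
  ((phi x + conjugate phi v)%dE = (dot v x)%:E /\
   conjugate phi v = (conjugate (f0_plus_scal f0 F y) v + conjugate g y)%dE)
  <->
  ((ocomp F g x + conjugate g y)%dE = scalarization F y x /\
   (f0_plus_scal f0 F y x + conjugate (f0_plus_scal f0 F y) v)%dE = (dot v x)%:E).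
Proof.
have Y := conjugate_ge phi v x; have Y1 := conjugate_ge (f0_plus_scal f0 F y) v x.
move: Y Y1 (weak_duality v y); rewrite /dual_obj.
set c := conjugate phi v; set c1 := conjugate _ v.
rewrite /f0_plus_comp /ocomp /f0_plus_scal /scalarization.
case Fx : (F x) => [z|] Y Y1 W.
  exact: duality_gap Y1 (conjugate_ge g y z) Y W.
(* Off the domain of [F] both pairs fail, each equating [+oo] with the real [dot v x]. *)
by split => [[]|[_]]; rewrite ?daddey daddye.
Qed.

Lemma perturbation_row x u : pert (row_mx x u) =
  if F x is Some z then (f0 x + g (z + u)%R)%dE else +oo.
Proof. by rewrite /perturbation row_mxKl row_mxKr. Qed.

Lemma perturbation0 x : pert (row_mx x 0%R) = phi x.
Proof. by rewrite perturbation_row /f0_plus_comp; case: (F x) => // z;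
  rewrite addr0. Qed.

Lemma feasible_perturbationsE :
  U = [set (w - z)%R | w in edom g & z in oimage F (edom f0 `&` odom F)].
Proof.
apply/seteqP; split=> u.
  move=> /ereal_inf_lt[_ [x _ <-]]; rewrite perturbation_row.
  case Fx : (F x) => [z|] //; rewrite dadd_lty => /andP[f0x gz].
  exists (z + u)%R => //; exists z; last by rewrite addrC addKr.
  by exists x => //; split => //; rewrite /odom /= Fx.
move=> [w gw [z [x [f0x _] Fx] <-]].
apply: (@le_lt_trans _ _ (pert (row_mx x (w - z)%R))).
  by apply: ereal_inf_lbound; exists x.
by rewrite perturbation_row Fx dadd_lty f0x subrKC.
Qed.

Lemma dot_row_mx x x' u u' :
  dot (row_mx x u) (row_mx x' u') = (dot x x' + dot u u')%R.
Proof.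
rewrite /dot big_split_ord; congr (_ + _)%R; apply: eq_bigr => i _.
  by rewrite !row_mxEl.
by rewrite !row_mxEr.
Qed.

(** * Closure formula and dual attainment for a proper perturbation function *)

Section Proper.
Hypothesis pert_proper : Defs.proper pert.

Lemma proper_perturbation_fin : exists x z w (r s : R),
  [/\ F x = Some z, f0 x = r%:E & g w = s%:E].
Proof.
have [[xu pxu] pN] := pert_proper; move: pxu (pN xu).
rewrite /perturbation; set x := lsubmx xu; set u := rsubmx xu.
case Fx : (F x) => [z|] //; rewrite -ltey dadd_lty => /andP[f0y gy] N.
have [r fr] : exists r, f0 x = r%:E.
  by apply: fin_of_lty => //; exact: dadd_gtNy N gy.
have [s gs] : exists s, g (z + u)%R = s%:E.
  by apply: fin_of_lty => //; apply: dadd_gtNy f0y; rewrite daddeC.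
by exists x, z, (z + u)%R, r, s.
Qed.

(** Substituting [u = w - F x] separates [x] from [w], so the suprema can be taken one after the
    other. The finite values at [x0] and [w0] keep the first one real, so that it can be
    subtracted. *)
Lemma dual_obj_le_of_minorant v y (c : R) :
  (forall x u, (c + dot v x + dot y u)%:E <= pert (row_mx x u)) ->
  dobj v y <= (- c)%:E.
Proof.
move=> H; have [x0 [z0 [w0 [r0 [s0 [Fx0 fx0 gw0]]]]]] := proper_perturbation_fin.
have H' x z w : F x = Some z ->
    (c + dot v x + dot y w - dot y z)%:E <= (f0 x + g w)%dE.
  move=> Fx; have := H x (w - z)%R; rewrite perturbation_row Fx subrKC.
  by rewrite dotDr dotNr addrA.
have bnd s w : g w = s%:E ->
    conjugate (f0_plus_scal f0 F y) v <= (- c - (dot y w - s))%:E.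
  move=> gw; apply/conjugate_leP => x; rewrite /f0_plus_scal /scalarization.
  case Fx : (F x) => [z|]; last by rewrite daddey leey.
  have := H' x z w Fx; rewrite gw !le_dadd_fin; apply: le_trans.
  by rewrite lee_fin; lra.
have := conjugate_ge (f0_plus_scal f0 F y) v x0.
rewrite {1}/f0_plus_scal /scalarization Fx0 fx0 daddE -EFinB => lb.
have [r rE] : exists r, conjugate (f0_plus_scal f0 F y) v = r%:E.
  by apply: fin_between (bnd _ _ gw0); apply: lt_le_trans lb; exact: ltNyr.
apply/dadd_leP; exists r, (- c - r)%R; rewrite rE; split => //; last by rewrite subrKC.
apply/conjugate_leP => w; have := H' _ _ w Fx0; rewrite fx0.
case gw : (g w) => [s| |] // _; last by rewrite leey.
by have := bnd _ _ gw; rewrite rE !lee_fin; lra.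
Qed.

(** The slope of an affine minorant of the perturbation function is a point where [rho] is below
    [+oo]; a point feasible at [u = 0] keeps the conjugate, hence [rho], above [-oo]. *)
Lemma econvex_perturbation_proper_rho : econvex pert -> U 0%R -> Gamma rho.
Proof.
move=> /econvexP cpert /ereal_inf_lt[_ [x _ <-] px].
split; last exact: econvex_rho.
split=> [|v].
  have [yy [c hc]] := exists_affine_minorant _ cpert
    (proper_epi_nonempty _ pert_proper) (fiber_bounded _ (proj2 pert_proper)).
  exists (lsubmx yy); rewrite -ltey.
  apply: le_lt_trans (rho_le _ (rsubmx yy)) _.
  apply: (@le_lt_trans _ _ (- c)%:E); last exact: ltry.
  apply: dual_obj_le_of_minorant => x' u.
  rewrite -addrA -dot_row_mx hsubmxK.
  have := proj2 pert_proper (row_mx x' u).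
  case E : (pert (row_mx x' u)) => [s| |] // _; last by rewrite leey.
  by rewrite lee_fin; apply: hc; rewrite E.
apply: lt_le_trans (weak_duality_rho v); apply: lt_le_trans (conjugate_ge phi v x).
have [s sE] := fin_of_lty _ (proj2 pert_proper _) px.
by rewrite -perturbation0 sE ltNyr.
Qed.

(** If [(v0, A)] missed the closed epigraph, [rho] would have an affine minorant of slope [xh] and
    value [A + r] at [v0]. The bound [A] on the conjugate puts [(xh, 0)] at height
    [dot xh v0 - (A + r)] outside the closed epigraph of the perturbation function. An affine
    minorant of the latter then has slopes [v], [y] for which [rho v] falls below the minorant of
    [rho]. *)
Lemma conjugate_eq_cl_rho v0 : econvex pert -> eclosed pert -> Gamma rho ->
  conjugate phi v0 = efun_cl rho v0.
Proof.
move=> /econvexP cpert clpert [rho_proper _]; apply/eqP;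
  rewrite eq_le conjugate_le_cl_rho/=.
apply: lee_real_ub => A conjA; suff : epi (efun_cl rho) (v0, A) by [].
rewrite epi_efun_cl; apply: contrapT => /not_closure_epi[r r0 rho_near].
have [xh hxh] := support_of_local_bound _ _ _ _ (proj1 (econvexP _) econvex_rho)
  (proper_epi_nonempty _ rho_proper) (fiber_bounded _ (proj2 rho_proper)) r0 rho_near.
have [pxh|npxh] := pselect (epi pert (row_mx xh 0%R, dot xh v0 - (A + r))%R).
  move/conjugate_leP: conjA => /(_ xh); move: pxh; rewrite /epi /= perturbation0 dotC.
  by move=> /[swap]/le_trans/[apply]; rewrite lee_fin; lra.
have : ~ closure (epi pert) (row_mx xh 0%R, dot xh v0 - (A + r))%R.
  by have /closure_id <- := clpert.
move=> /not_closure_epi[r' r'0 pert_near].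
have [yy hyy] := support_of_local_bound _ _ _ _ cpert
  (proper_epi_nonempty _ pert_proper) (fiber_bounded _ (proj2 pert_proper)) r'0 pert_near.
pose v := lsubmx yy; pose y := rsubmx yy.
have yyE : yy = row_mx v y by rewrite hsubmxK.
have := hxh v (- (dot xh v0 - (A + r) + r' - dot v xh))%R.
have -> : rho v <= (- (dot xh v0 - (A + r) + r' - dot v xh))%:E.
  apply: le_trans (rho_le _ y) _; apply: dual_obj_le_of_minorant => x u.
  have := proj2 pert_proper (row_mx x u).
  case E : (pert (row_mx x u)) => [s| |] // _; last by rewrite leey.
  rewrite lee_fin; have := hyy (row_mx x u) s; rewrite E lexx => /(_ isT).
  by rewrite yyE opp_row_mx add_row_mx dot_row_mx oppr0 addr0 dotDr dotNr; lra.
by move=> /(_ isT); rewrite dotDr dotNr (dotC xh v); lra.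
Qed.

(** Stands for the epigraph of the value function; as the infimum over [x] may not be attained, its
    fibres may be open half-lines. *)
Definition value_rel v u (a : R) := exists x, pert (row_mx x u) <= (a + dot v x)%:E.

Lemma convex_value_rel v : econvex pert -> convex_rel (value_rel v).
Proof.
move=> /econvexP cpert u a u' a' s s01 [x px] [x' px'].
exists ((1 - s) *: x + s *: x')%R.
have := cpert _ _ _ _ _ s01 px px'.
rewrite !scale_row_mx add_row_mx => /le_trans; apply.
by rewrite lee_fin dotDr !dotZr le_eqVlt; apply/orP; left; apply/eqP; ring.
Qed.

Lemma value_rel_feasible v u a : value_rel v u a -> U u.
Proof.
move=> [x px]; apply: (@le_lt_trans _ _ (pert (row_mx x u))).
  by apply: ereal_inf_lbound; exists x.
by apply: le_lt_trans px _; exact: ltry.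
Qed.

Lemma feasible_value_rel v u : U u -> exists a, value_rel v u a.
Proof.
move=> /ereal_inf_lt[_ [x _ <-] px].
have [s sE] := fin_of_lty _ (proj2 pert_proper _) px.
by exists (s - dot v x)%R, x; rewrite sE subrK.
Qed.

Lemma value_rel0 v (c : R) : conjugate phi v = (- c)%:E ->
  (forall a, value_rel v 0%R a -> (c <= a)%R) /\
  (forall e, (0 < e)%R -> exists2 a, (a < c + e)%R & value_rel v 0%R a).
Proof.
move=> conjE; split=> [a [x]|e e0].
  have : conjugate phi v <= (- c)%:E by rewrite conjE.
  move=> /conjugate_leP/(_ x) /[swap]; rewrite perturbation0 =>
    /[swap]/le_trans/[apply].
  by rewrite lee_fin; lra.
apply: contrapT => H.
have : conjugate phi v <= (- (c + e))%:E; last by rewrite conjE lee_fin; lra.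
apply/conjugate_leP => x; rewrite -perturbation0; have :=
  proj2 pert_proper (row_mx x 0%R).
case E : (pert _) => [s| |] // _; last by rewrite leey.
rewrite lee_fin leNgt; apply/negP => sx; apply: H.
exists (s - dot v x)%R; first by lra.
by exists x; rewrite E subrK.
Qed.

Lemma support_value_rel v (c : R) : econvex pert -> conjugate phi v = (- c)%:E ->
  (rint U 0%R \/ (U 0%R /\ piecewise_linear_quadratic pert)) ->
  exists y, forall u a, value_rel v u a -> (c + dot y u <= a)%R.
Proof.
move=> cpert conjE; have cK := convex_value_rel v cpert.
have [K0 Kc] := value_rel0 _ _ conjE.
case=> [[_ /nbhs_ballP[r /= r0 near0]]|[_ plqf]].
  apply: support_at_core => // u a /value_rel_feasible Uu.
  (* Then [- (e *: u)] lies in the ball, and in the affine hull because it is on the line through 0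
     and [u]. *)
  pose e := (r / (`|u| + 1))%R.
  have dn : (0 < `|u| + 1)%R by rewrite ltr_wpDl.
  have e0 : (0 < e)%R by rewrite divr_gt0.
  exists e => //; apply: feasible_value_rel; apply: near0.
    rewrite -ball_normE /= sub0r opprK normrZ gtr0_norm// mulrAC ltr_pdivrMr//.
    by rewrite ltr_pM2l// ltrDl.
  have U0 : U 0%R by have [a0 _ /value_rel_feasible] := Kc 1%R ltr01.
  move=> S [affS US]; have := affS 0%R u (- e)%R (US _ U0) (US _ Uu).
  by rewrite scaler0 add0r scaleNr.
(* The [x] directions are eliminated inside the joint space, the result being read at the points
   [row_mx 0 u]. *)
pose K (z : 'rV[R]_(n + m)) (a : R) := pert z <= (a + dot (row_mx v 0%R) z)%:E.
have KE x u a : K (row_mx x u) a = (pert (row_mx x u) <= (a + dot v x)%:E).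
  by rewrite /K dot_row_mx dot0l addr0.
have convK : convex_rel K.
  move=> z a z' a' s s01 Kz Kz'; have /econvexP/(_ _ _ _ _ _ s01 Kz Kz') := cpert.
  move=> /le_trans; apply; rewrite lee_fin dotDr !dotZr.
  by rewrite le_eqVlt; apply/orP; left; apply/eqP; ring.
have plqK : plq K by exact: plq_epigraph.
pose D (i : 'I_n) : 'rV[R]_(n + m) := row_mx (delta_mx ord0 i) 0%R.
pose ds := [seq D i | i <- index_enum 'I_n].
have to_proj x u a : K (row_mx x u) a -> proj_dirs ds K (row_mx 0%R u) a.
  move=> Kxu; apply: (proj_dirs_shift _ _ _ (fun i => x ord0 i)).
  rewrite (_ : \sum_(i <- _) _ = row_mx x 0)%R; first by rewrite add_row_mx add0r addr0.
  rewrite [in RHS](row_sum_delta x).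
  rewrite (big_morph (fun x' : 'rV_n => row_mx x' (0 : 'rV[R]_m)) (id1 :=
    0%R) (op1 := +%R)).
  - by apply: eq_bigr => i _; rewrite scale_row_mx scaler0.
  - by move=> x1 x2; rewrite add_row_mx addr0.
  - exact: row_mx0.
(* This converse is needed only over [u = 0], to transfer the value there; calmness uses [to_proj]
   alone. *)
have of_proj a : proj_dirs ds K 0%R a -> value_rel v 0%R a.
  move=> /(proj_dirsE (fun z : 'rV[R]_(n + m) => rsubmx z = 0%R))[||w w0].
  - exact: linear0.
  - by move=> w t d w0 /mapP[i _ ->];
    rewrite linearD linearZ /= w0 row_mxKr scaler0 addr0.
  - by rewrite add0r -[w]hsubmxK w0 KE => Kw; exists (lsubmx w).
have proj0 a : value_rel v 0%R a -> proj_dirs ds K 0%R a.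
  by move=> [x px]; rewrite -row_mx0; apply: (to_proj x); rewrite KE.
have plqP : plq (proj_dirs ds K).
  apply: (plq_proj_dirs _ _ 0%R c) => //.
    by have [a _ /proj0 Ka] := Kc 1%R ltr01; exists a.
  by move=> a /of_proj/K0.
have [||L L0 calm] := plq_calm _ c plqP (convex_rel_proj_dirs _ _ convK).
- by move=> a /of_proj/K0.
- by move=> e /Kc[a ace /proj0]; exists a.
apply: (support_of_calm _ _ _ cK L0) => u a [x px].
have : proj_dirs ds K (row_mx 0%R u) a by apply: (to_proj x); rewrite KE.
move=> /calm; rewrite /norm1 big_split_ord /= big1 ?add0r => [|i _].
  by under eq_bigr do rewrite row_mxEr.
by rewrite row_mxEl mxE normr0.
Qed.

Lemma strong_duality v : econvex pert ->
  (rint U 0%R \/ (U 0%R /\ piecewise_linear_quadratic pert)) ->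
  exists y, dobj v y <= conjugate phi v.
Proof.
move=> cpert hyp.
have U0 : U 0%R by case: hyp => [[h /nbhs_singleton]|[]//]; exact.
have /ereal_inf_lt[_ [x0 _ <-] px0] := U0.
have [s0 sE] := fin_of_lty _ (proj2 pert_proper _) px0.
have := conjugate_ge phi v x0; rewrite -perturbation0 sE => lb.
(* The point [x0] excludes [-oo]; at [+oo] any [y] will do. *)
case E : (conjugate phi v) lb => [c| |] // _; last by exists 0%R; rewrite leey.
have [|y hy] := support_value_rel v (- c)%R cpert _ hyp; first by rewrite opprK.
exists y; rewrite -[c]opprK; apply: dual_obj_le_of_minorant => x u.
have := proj2 pert_proper (row_mx x u).
case Ep : (pert (row_mx x u)) => [s| |] // _; last by rewrite leey.
have /hy : value_rel v u (s - dot v x)%R by exists x; rewrite Ep subrK.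
by rewrite lee_fin; lra.
Qed.

End Proper.
End Duality.

Theorem theorem3p1 (R : realType) (n m : nat)
    (f0 : 'rV[R]_n -> \bar R) (F : 'rV[R]_n -> option 'rV[R]_m)
    (g : 'rV[R]_m -> \bar R) :
  [/\ econvex (rho f0 F g),
      forall v : 'rV[R]_n,
        conjugate (f0_plus_comp f0 F g) v <= efun_cl (rho f0 F g) v,
      forall (v x : 'rV[R]_n) (y : 'rV[R]_m),
        ((f0_plus_comp f0 F g x + conjugate (f0_plus_comp f0 F g) v)%dE
            = (dot v x)%:E /\
         conjugate (f0_plus_comp f0 F g) v
            = (conjugate (f0_plus_scal f0 F y) v + conjugate g y)%dE)
        <->
        ((ocomp F g x + conjugate g y)%dE = scalarization F y x /\
         (f0_plus_scal f0 F y x + conjugate (f0_plus_scal f0 F y) v)%dE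
            = (dot v x)%:E),
      feasible_perturbations f0 F g =
        [set (w - z)%R | w in edom g & z in oimage F (edom f0 `&` odom F)]
    & Gamma0 (perturbation f0 F g) ->
      [/\ feasible_perturbations f0 F g 0%R -> Gamma (rho f0 F g),
          Gamma (rho f0 F g) ->
            forall v : 'rV[R]_n,
              conjugate (f0_plus_comp f0 F g) v = efun_cl (rho f0 F g) v
        & rint (feasible_perturbations f0 F g) 0%R \/
          (feasible_perturbations f0 F g 0%R /\
           piecewise_linear_quadratic (perturbation f0 F g)) ->
            Gamma0 (rho f0 F g) /\
            forall v : 'rV[R]_n, exists y : 'rV[R]_m,
              rho f0 F g v =
                (conjugate (f0_plus_scal f0 F y) v + conjugate g y)%dE]].
Proof.
split.
- exact: econvex_rho.
- exact: conjugate_le_cl_rho.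
- exact: optimality_conditions.
- exact: feasible_perturbationsE.
move=> [[fprop fconv] fclosed]; split=> [U0|G v|hyp].
- exact: econvex_perturbation_proper_rho.
- exact: conjugate_eq_cl_rho.
have attained v : exists y, rho f0 F g v = dual_obj f0 F g v y /\
    rho f0 F g v = conjugate (f0_plus_comp f0 F g) v.
  have [y hy] := strong_duality _ _ _ fprop v fconv hyp.
  have h1 := weak_duality_rho f0 F g v; have h2 := rho_le f0 F g v y.
  exists y; split; apply/eqP; rewrite eq_le ?h1 ?h2 ?andbT/=.
    exact: le_trans hy h1.
  exact: le_trans h2 hy.
(* Being a conjugate, [rho] is closed. *)
have rhoE : rho f0 F g = conjugate (f0_plus_comp f0 F g).
  by apply/funext => v; have [y []] := attained v.
split; last by move=> v; have [y []] := attained v; exists y.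
split; last by rewrite rhoE; exact: eclosed_conjugate.
apply: econvex_perturbation_proper_rho => //.
by case: hyp => [[h /nbhs_singleton]|[]//]; exact.
Qed.
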